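(* Let $\mathcal{L}$ be a left bialgebroid over $B$. For any $\Sigma\in C^{2}(\mathcal{L},B)$, with convolution inverse $\Sigma^{-1}$, the formula $$\partial\Sigma(X,Y,Z)=\Sigma\big(X_{(1)},\Sigma(Y_{(1)},Z_{(1)})\,Y_{(2)}Z_{(2)}\big)\,\Sigma^{-1}\big(\overline{\Sigma^{-1}(X_{(3)},Y_{(4)})}\,X_{(2)}Y_{(3)},Z_{(3)}\big),\qquad X,Y,Z\in\mathcal{L},$$ defines an invertible normalised $3$-cocycle $\partial\Sigma$ making $\mathcal{L}^{\Sigma}$ a left $B$-coquasi-bialgebroid, where $\mathcal{L}^\Sigma$ is the $B$-coalgebroid $\mathcal{L}$ with product $X\cdot_{\Sigma}Y=\Sigma(X_{(1)},Y_{(1)})\,\overline{\Sigma^{-1}(X_{(3)},Y_{(3)})}\,X_{(2)}Y_{(2)}$.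
   Context: $k$ is a field, $B$ a unital associative $k$-algebra, $\overline{B}$ its opposite algebra with the antiisomorphism $b\mapsto\overline{b}$, and $B^e=B\otimes\overline{B}$. $B$ is a left $B^e$-module by $(b\overline{c})\cdot a=bac$. For $B^e$-bimodules $M,N$: $M\diamond_B N:=M\otimes N/\langle \overline{b}m\otimes n-m\otimes bn\rangle$, and the Takeuchi product $M\times_B N\subseteq M\diamond_B N$ consists of the elements $\sum_i m_i\otimes n_i$ with $\sum_i m_i\overline{b}\otimes n_i=\sum_i m_i\otimes n_i b$ for all $b\in B$; $B^e$ acts on it from the left by $b\overline{c}(m\otimes n)=bm\otimes\overline{c}n$. The triple product $M\times_B P\times_B N$ is defined analogously: take the quotient of $M\otimes P\otimes N$ by $\overline{b}m\otimes p\otimes n=m\otimes bp\otimes n$ and $m\otimes\overline{b}p\otimes n=m\otimes p\otimes bn$, and the elements invariant in the sense $\sum m\overline{b}\otimes p\otimes n=\sum m\otimes pb\otimes n$, $\sum m\otimes p\overline{b}\otimes n=\sum m\otimes p\otimes nb$. A left $B$-coalgebroid ($\times_B$-coalgebra) is a $B^e$-bimodule $\mathcal{L}$ with left $B^e$-module maps $\Delta:\mathcal{L}\to\mathcal{L}\times_B\mathcal{L}$, $\Delta(X)=X_{(1)}\otimes X_{(2)}$, and $\varepsilon:\mathcal{L}\to B$, such that $\Delta$ is coassociative (the two iterated coproducts agree in $\mathcal{L}\times_B\mathcal{L}\times_B\mathcal{L}$) and $\varepsilon(X_{(1)})X_{(2)}=X=\overline{\varepsilon(X_{(2)})}X_{(1)}$.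 A left $B$-coquasi-bialgebroid is a unital, not necessarily associative algebra $\mathcal{L}$ with algebra maps $s:B\to\mathcal{L}$, $t:\overline{B}\to\mathcal{L}$ with commuting images, which is also a left $B$-coalgebroid for the $B^e$-bimodule structure given by multiplication with $s,t$ (write $bX=s(b)X$, $\overline{b}X=t(b)X$, $Xb=Xs(b)$, $X\overline{b}=Xt(b)$), such that: (i) $\Delta:\mathcal{L}\to\mathcal{L}\times_B\mathcal{L}$ is an algebra map (factorwise product on the target). (ii) $\varepsilon(1)=1_B$ and $\varepsilon(X\varepsilon(Y))=\varepsilon(XY)=\varepsilon(X\overline{\varepsilon(Y)})$. (iii) There is a convolution-invertible $\Phi\in\mathrm{Hom}_{B^e-}(\mathcal{L}\otimes_{B^e}\mathcal{L}\otimes_{B^e}\mathcal{L},B)$ (an invertible normalised $3$-cocycle) such that for all $X,Y,Z,W\in\mathcal{L}$, $b\in B$: (1) $\Phi(1,X,Y)=\Phi(X,1,Y)=\Phi(X,Y,1)=\varepsilon(XY)$; (2) $\Phi(X,Y,Zb)=\Phi(X,Y,Z\overline{b})$; (3) $\Phi(X_{(1)},Y_{(1)},Z_{(1)}W_{(1)})\Phi(X_{(2)}Y_{(2)},Z_{(2)},W_{(2)})=\Phi(X_{(1)},\Phi(Y_{(1)},Z_{(1)},W_{(1)})Y_{(2)}Z_{(2)},W_{(2)})\Phi(X_{(2)},Y_{(3)},Z_{(3)})$; (4) $\Phi(X_{(1)},Y_{(1)},Z_{(1)})\,(X_{(2)}Y_{(2)})Z_{(2)}=\overline{\Phi(X_{(2)},Y_{(2)},Z_{(2)})}\,X_{(1)}(Y_{(1)}Z_{(1)})$.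 A left bialgebroid over $B$ is the case of trivial $\Phi$, i.e. $\Phi(X,Y,Z)=\varepsilon(XYZ)$ (so the product is associative). Here $\mathrm{Hom}_{B^e-}$ denotes left $B^e$-linear maps and $\mathcal{L}\otimes_{B^e}\mathcal{L}$ uses right and left multiplication by $s,t$. The convolution product on $\mathrm{Hom}_{B^e-}(\mathcal{L}\otimes_{B^e}\mathcal{L},B)$ is $(f\star g)(X,Y)=f(X_{(1)},Y_{(1)})g(X_{(2)},Y_{(2)})$ with unit $(X,Y)\mapsto\varepsilon(XY)$, and similarly for three arguments with unit $\varepsilon(XYZ):=\varepsilon((XY)Z)=\varepsilon(X(YZ))$. $C^{2}(\mathcal{L},B)$ denotes the unital ($\Sigma(1,X)=\Sigma(X,1)=\varepsilon(X)$) convolution-invertible maps $\Sigma\in\mathrm{Hom}_{B^e-}(\mathcal{L}\otimes_{B^e}\mathcal{L},B)$ with $\Sigma(X,Y\overline{b})=\Sigma(X,Yb)$ for all $X,Y\in\mathcal{L}$, $b\in B$. *)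

(* Defs.v *)
From HB Require Import structures.
From mathcomp Require Import all_boot all_algebra ring_quotient.
From mathcomp Require Import boolp.
From mathcomp.multinomials Require Import freeg.

Set Implicit Arguments.
Unset Strict Implicit.
Unset Printing Implicit Defensive.

Import GRing.Theory.
Local Open Scope ring_scope.

Section Presentation.
Variables (V : zmodType) (rel : V -> Prop).

Inductive spanned : V -> Prop :=
| spanned_gen x of rel x : spanned x
| spanned0 : spanned 0
| spannedB x y of spanned x & spanned y : spanned (x - y).

Definition relators : {pred V} := fun x => `[< spanned x >].

Lemma relators_zmod_closed : zmod_closed relators.
Proof.
split=> [|x y]; first exact/asboolP/spanned0.
by move=> /asboolP Rx /asboolP Ry; apply/asboolP/spannedB.
Qed.

HB.instance Definition _ :=
  GRing.isZmodClosed.Build V relators relators_zmod_closed.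

Definition presented : Type := Quotient.quot relators.
HB.instance Definition _ := GRing.Zmodule.on presented.

Definition class_of (x : V) : presented := (\pi_(Quotient.quot relators) x)%qT.

Fact class_of_is_zmod_morphism : zmod_morphism class_of.
Proof. by move=> x y; rewrite /class_of !piE. Qed.

HB.instance Definition _ := GRing.isZmodMorphism.Build V presented
  class_of class_of_is_zmod_morphism.

Lemma class_of_eq x y : rel (x - y) -> class_of x = class_of y.
Proof.
move=> Rxy; apply/eqP; rewrite -Quotient.idealrBE.
exact/asboolP/spanned_gen.
Qed.

Lemma class_of_surj (u : presented) : exists x, u = class_of x.
Proof. by exists (repr u); rewrite /class_of reprK. Qed.

End Presentation.

(* A left (right) module over B^e = B (x) Bbar is a vector space with commuting
   actions of B and of its opposite Bbar.  The element of Bbar attached to b is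
   b itself, so [lactbar b m] is \bar b m and the actions of Bbar reverse
   products. *)
Record be_bimod (k : fieldType) (B : algType k) := BeBimod {
  be_car :> lmodType k;
  lact : B -> be_car -> be_car;
  lactbar : B -> be_car -> be_car;
  ract : be_car -> B -> be_car;
  ractbar : be_car -> B -> be_car;
  lact_linearl : forall m, linear (lact^~ m);
  lact_linearr : forall b, linear (lact b);
  lactbar_linearl : forall m, linear (lactbar^~ m);
  lactbar_linearr : forall b, linear (lactbar b);
  ract_linearl : forall b, linear (ract^~ b);
  ract_linearr : forall m, linear (ract m);
  ractbar_linearl : forall b, linear (ractbar^~ b);
  ractbar_linearr : forall m, linear (ractbar m);
  lact1 : forall m, lact 1 m = m;
  lactbar1 : forall m, lactbar 1 m = m;
  ract1 : forall m, ract m 1 = m;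
  ractbar1 : forall m, ractbar m 1 = m;
  lactM : forall b c m, lact (b * c) m = lact b (lact c m);
  lactbarM : forall b c m, lactbar (b * c) m = lactbar c (lactbar b m);
  ractM : forall m b c, ract m (b * c) = ract (ract m b) c;
  ractbarM : forall m b c, ractbar m (b * c) = ractbar (ractbar m c) b;
  lact_lactbar : forall b c m, lact b (lactbar c m) = lactbar c (lact b m);
  ract_ractbar : forall m b c, ract (ractbar m c) b = ractbar (ract m b) c;
  lact_ract : forall b m c, lact b (ract m c) = ract (lact b m) c;
  lact_ractbar : forall b m c, lact b (ractbar m c) = ractbar (lact b m) c;
  lactbar_ract : forall b m c, lactbar b (ract m c) = ract (lactbar b m) c;
  lactbar_ractbar : forall b m c,
    lactbar b (ractbar m c) = ractbar (lactbar b m) c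
}.

Section Diamond.
Variables (k : fieldType) (B : algType k).
Implicit Types M N P : be_bimod B.

Notation "<[ x ]>f" := (<< x >> : {freeg _ / int}) (format "<[ x ]>f").

Inductive diamond_rel M N : {freeg (M * N) / int} -> Prop :=
| diamond_addl m m' n :
    diamond_rel (<[(m + m', n)]>f - (<[(m, n)]>f + <[(m', n)]>f))
| diamond_addr m n n' :
    diamond_rel (<[(m, n + n')]>f - (<[(m, n)]>f + <[(m, n')]>f))
| diamond_scale (a : k) m n :
    diamond_rel (<[(a *: m, n)]>f - <[(m, a *: n)]>f)
| diamond_bal b m n :
    diamond_rel (<[(lactbar b m, n)]>f - <[(m, lact b n)]>f).

Definition diamond M N : Type := presented (@diamond_rel M N).
HB.instance Definition _ M N := GRing.Zmodule.on (diamond M N).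

Definition pure2 M N (m : M) (n : N) : diamond M N :=
  class_of (@diamond_rel M N) <[(m, n)]>f.

Inductive diamond3_rel M P N : {freeg (M * P * N) / int} -> Prop :=
| diamond3_add1 m m' p n :
    diamond3_rel (<[(m + m', p, n)]>f - (<[(m, p, n)]>f + <[(m', p, n)]>f))
| diamond3_add2 m p p' n :
    diamond3_rel (<[(m, p + p', n)]>f - (<[(m, p, n)]>f + <[(m, p', n)]>f))
| diamond3_add3 m p n n' :
    diamond3_rel (<[(m, p, n + n')]>f - (<[(m, p, n)]>f + <[(m, p, n')]>f))
| diamond3_scale12 (a : k) m p n :
    diamond3_rel (<[(a *: m, p, n)]>f - <[(m, a *: p, n)]>f)
| diamond3_scale23 (a : k) m p n :
    diamond3_rel (<[(m, a *: p, n)]>f - <[(m, p, a *: n)]>f)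
| diamond3_bal12 b m p n :
    diamond3_rel (<[(lactbar b m, p, n)]>f - <[(m, lact b p, n)]>f)
| diamond3_bal23 b m p n :
    diamond3_rel (<[(m, lactbar b p, n)]>f - <[(m, p, lact b n)]>f).

Definition diamond3 M P N : Type := presented (@diamond3_rel M P N).
HB.instance Definition _ M P N := GRing.Zmodule.on (diamond3 M P N).

Definition pure3 M P N (m : M) (p : P) (n : N) : diamond3 M P N :=
  class_of (@diamond3_rel M P N) <[(m, p, n)]>f.

Lemma pure2Dl M N (m m' : M) (n : N) :
  pure2 (m + m') n = pure2 m n + pure2 m' n.
Proof. rewrite /pure2 -raddfD; exact/class_of_eq/diamond_addl. Qed.

Lemma pure3D1 M P N (m m' : M) (p : P) (n : N) :
  pure3 (m + m') p n = pure3 m p n + pure3 m' p n.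
Proof. rewrite /pure3 -raddfD; exact/class_of_eq/diamond3_add1. Qed.

Lemma freeg_intU (K : choiceType) (c : int) (x : K) :
  << c *g x >> = <[x]>f *~ c.
Proof. by rewrite freegU_mulz intz. Qed.

Lemma diamond_repr M N (t : diamond M N) :
  exists r : seq (M * N), t = \sum_(x <- r) pure2 x.1 x.2.
Proof.
have [D ->] := class_of_surj t; rewrite -[D]freeg_sumE raddf_sum /=.
exists [seq (z.1 *~ coeff z D, z.2) | z <- dom D].
rewrite [RHS]big_map; apply: eq_bigr => -[m n] _ /=.
have pure0 : @pure2 M N 0 n = 0.
  by apply: (addrI (pure2 0 n)); rewrite -pure2Dl !addr0.
pose f x := pure2 x n : diamond M N.
have fB : zmod_morphism f.
  by move=> x y; apply/eqP; rewrite eq_sym subr_eq /f -pure2Dl subrK.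
pose F : {additive M -> diamond M N} :=
  HB.pack f (GRing.isZmodMorphism.Build _ _ f fB).
by rewrite freeg_intU raddfMz; rewrite -[RHS]/(F _) raddfMz.
Qed.

Lemma diamond3_repr M P N (t : diamond3 M P N) :
  exists r : seq (M * P * N), t = \sum_(x <- r) pure3 x.1.1 x.1.2 x.2.
Proof.
have [D ->] := class_of_surj t; rewrite -[D]freeg_sumE raddf_sum /=.
exists [seq (z.1.1 *~ coeff z D, z.1.2, z.2) | z <- dom D].
rewrite [RHS]big_map; apply: eq_bigr => -[[m p] n] _ /=.
pose f x := pure3 x p n : diamond3 M P N.
have fB : zmod_morphism f.
  by move=> x y; apply/eqP; rewrite eq_sym subr_eq /f -pure3D1 subrK.
pose F : {additive M -> diamond3 M P N} :=
  HB.pack f (GRing.isZmodMorphism.Build _ _ f fB).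
by rewrite freeg_intU raddfMz; rewrite -[RHS]/(F _) raddfMz.
Qed.

(* Chosen representatives: a map out of a diamond product given on pure tensors
   by a balanced expression f is evaluated as the sum of f over them. *)
Definition rep2 M N (t : diamond M N) : seq (M * N) :=
  projT1 (cid (diamond_repr t)).

Definition rep3 M P N (t : diamond3 M P N) : seq (M * P * N) :=
  projT1 (cid (diamond3_repr t)).

Definition takeuchi M N (t : diamond M N) : Prop := forall b : B,
  \sum_(x <- rep2 t) pure2 (ractbar x.1 b) x.2 =
  \sum_(x <- rep2 t) pure2 x.1 (ract x.2 b).

Definition takeuchi3 M P N (t : diamond3 M P N) : Prop := forall b : B,
  \sum_(x <- rep3 t) pure3 (ractbar x.1.1 b) x.1.2 x.2 =
    \sum_(x <- rep3 t) pure3 x.1.1 (ract x.1.2 b) x.2 /\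
  \sum_(x <- rep3 t) pure3 x.1.1 (ractbar x.1.2 b) x.2 =
    \sum_(x <- rep3 t) pure3 x.1.1 x.1.2 (ract x.2 b).

Definition diamond_lact M N (b : B) (t : diamond M N) : diamond M N :=
  \sum_(x <- rep2 t) pure2 (lact b x.1) x.2.

Definition diamond_lactbar M N (b : B) (t : diamond M N) : diamond M N :=
  \sum_(x <- rep2 t) pure2 x.1 (lactbar b x.2).

End Diamond.

(* B is a left B^e-module by (b \bar c) a = b a c.  Linearity of Delta over k is
   the case b = a%:A of Delta_lact. *)
Record coalgebroid (k : fieldType) (B : algType k) := Coalgebroid {
  coalg_bimod :> be_bimod B;
  Delta : coalg_bimod -> diamond coalg_bimod coalg_bimod;
  eps : coalg_bimod -> B;
  Delta_takeuchi : forall X, takeuchi (Delta X);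
  DeltaD : forall X Y, Delta (X + Y) = Delta X + Delta Y;
  Delta_lact : forall b X, Delta (lact b X) = diamond_lact b (Delta X);
  Delta_lactbar : forall b X,
    Delta (lactbar b X) = diamond_lactbar b (Delta X);
  eps_linear : linear eps;
  eps_lact : forall b X, eps (lact b X) = b * eps X;
  eps_lactbar : forall b X, eps (lactbar b X) = eps X * b;
  Delta_coassoc : forall X,
    let Xl := \sum_(x <- rep2 (Delta X)) \sum_(y <- rep2 (Delta x.1))
                pure3 y.1 y.2 x.2 in
    let Xr := \sum_(x <- rep2 (Delta X)) \sum_(y <- rep2 (Delta x.2))
                pure3 x.1 y.1 y.2 in
    [/\ takeuchi3 Xl, takeuchi3 Xr & Xl = Xr];
  counitl : forall X, \sum_(x <- rep2 (Delta X)) lact (eps x.1) x.2 = X;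
  counitr : forall X, \sum_(x <- rep2 (Delta X)) lactbar (eps x.2) x.1 = X
}.

Section Sweedler.
Variables (k : fieldType) (B : algType k) (L : coalgebroid B).

Definition sweedler_choice (d : L -> seq (L * L)) : Prop :=
  forall X, Delta X = \sum_(x <- d X) pure2 x.1 x.2.

Definition cop2 (X : L) : seq (L * L) := rep2 (Delta X).

Definition iter_cop3 (d : L -> seq (L * L)) (X : L) : seq (L * L * L) :=
  [seq (x.1, y.1, y.2) | x <- d X, y <- d x.2].

Definition iter_cop4 (d : L -> seq (L * L)) (X : L) : seq (L * L * L * L) :=
  [seq (x.1, y.1.1, y.1.2, y.2) | x <- d X, y <- iter_cop3 d x.2].

(* Hom_{B^e-}(L (x)_{B^e} L, B), as B^e-balanced maps of two variables. *)
Record hom2 (f : L -> L -> B) : Prop := Hom2 {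
  hom2_linearl : forall Y, linear (f^~ Y);
  hom2_linearr : forall X, linear (f X);
  hom2_bal : forall X b Y, f (ract X b) Y = f X (lact b Y);
  hom2_balbar : forall X b Y, f (ractbar X b) Y = f X (lactbar b Y);
  hom2_lact : forall b X Y, f (lact b X) Y = b * f X Y;
  hom2_lactbar : forall b X Y, f (lactbar b X) Y = f X Y * b
}.

Record hom3 (f : L -> L -> L -> B) : Prop := Hom3 {
  hom3_linear1 : forall Y Z, linear (fun X => f X Y Z);
  hom3_linear2 : forall X Z, linear (fun Y => f X Y Z);
  hom3_linear3 : forall X Y, linear (f X Y);
  hom3_bal12 : forall X b Y Z, f (ract X b) Y Z = f X (lact b Y) Z;
  hom3_bal12bar : forall X b Y Z, f (ractbar X b) Y Z = f X (lactbar b Y) Z;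
  hom3_bal23 : forall X Y b Z, f X (ract Y b) Z = f X Y (lact b Z);
  hom3_bal23bar : forall X Y b Z, f X (ractbar Y b) Z = f X Y (lactbar b Z);
  hom3_lact : forall b X Y Z, f (lact b X) Y Z = b * f X Y Z;
  hom3_lactbar : forall b X Y Z, f (lactbar b X) Y Z = f X Y Z * b
}.

Definition conv2 (f g : L -> L -> B) (X Y : L) : B :=
  \sum_(x <- cop2 X) \sum_(y <- cop2 Y) f x.1 y.1 * g x.2 y.2.

Definition conv3 (f g : L -> L -> L -> B) (X Y Z : L) : B :=
  \sum_(x <- cop2 X) \sum_(y <- cop2 Y) \sum_(z <- cop2 Z)
    f x.1 y.1 z.1 * g x.2 y.2 z.2.

(* lsrc and ltgt are the maps s : B -> L and t : Bbar -> L; as above, an element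
   of Bbar is given by the corresponding element of B. *)
Record alg_data := AlgData {
  lone : L;
  lmul : L -> L -> L;
  lsrc : B -> L;
  ltgt : B -> L
}.

Variable A : alg_data.
Notation "X *' Y" := (lmul A X Y) (at level 40, left associativity).

Definition eps2 (X Y : L) : B := eps (X *' Y).

Definition eps3 (X Y Z : L) : B := eps ((X *' Y) *' Z).

(* The last six fields (the product is a B^e-bimodule map from L (x)_{B^e} L)
   are what makes the factorwise product on the Takeuchi product independent of
   representatives; for a product satisfying coc_assoc below they follow from
   the special cases where one argument is 1, lsrc b or ltgt b. *)
Record is_algebra_over : Prop := IsAlgebraOver {
  mul_linearl : forall Y, linear (lmul A ^~ Y);
  mul_linearr : forall X, linear (lmul A X);
  mul1X : forall X, (lone A) *' X = X;
  mulX1 : forall X, X *' (lone A) = X;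
  src_linear : linear (lsrc A);
  src1 : lsrc A 1 = (lone A);
  srcM : forall b c, lsrc A (b * c) = lsrc A b *' lsrc A c;
  tgt_linear : linear (ltgt A);
  tgt1 : ltgt A 1 = (lone A);
  tgtM : forall b c, ltgt A (b * c) = ltgt A c *' ltgt A b;
  src_tgt : forall b c, lsrc A b *' ltgt A c = ltgt A c *' lsrc A b;
  lact_src : forall b X, lact b X = lsrc A b *' X;
  lactbar_tgt : forall b X, lactbar b X = ltgt A b *' X;
  ract_src : forall X b, ract X b = X *' lsrc A b;
  ractbar_tgt : forall X b, ractbar X b = X *' ltgt A b;
  mul_lact : forall b X Y, lact b X *' Y = lact b (X *' Y);
  mul_lactbar : forall b X Y, lactbar b X *' Y = lactbar b (X *' Y);
  mul_bal : forall X b Y, ract X b *' Y = X *' lact b Y;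
  mul_balbar : forall X b Y, ractbar X b *' Y = X *' lactbar b Y;
  mul_ract : forall X Y b, X *' ract Y b = ract (X *' Y) b;
  mul_ractbar : forall X Y b, X *' ractbar Y b = ractbar (X *' Y) b
}.

Record is_compatible : Prop := IsCompatible {
  Delta1 : Delta (lone A) = pure2 (lone A) (lone A);
  DeltaM : forall X Y, Delta (X *' Y) =
    \sum_(x <- cop2 X) \sum_(y <- cop2 Y) pure2 (x.1 *' y.1) (x.2 *' y.2);
  eps1 : eps (lone A) = 1;
  eps_ract : forall X Y, eps (ract X (eps Y)) = eps (X *' Y);
  eps_ractbar : forall X Y, eps (X *' Y) = eps (ractbar X (eps Y))
}.

Definition conv_inverse2 (S S' : L -> L -> B) : Prop :=
  [/\ hom2 S',
      forall X Y, conv2 S S' X Y = eps2 X Y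
    & forall X Y, conv2 S' S X Y = eps2 X Y].

Definition conv_inverse3 (F F' : L -> L -> L -> B) : Prop :=
  [/\ hom3 F',
      forall X Y Z, conv3 F F' X Y Z = eps3 X Y Z
    & forall X Y Z, conv3 F' F X Y Z = eps3 X Y Z].

Record normalised_cocycle3 (Phi : L -> L -> L -> B) : Prop := Cocycle3 {
  coc_hom : hom3 Phi;
  coc_inv : exists Psi, conv_inverse3 Phi Psi;
  coc_unit1 : forall X Y, Phi (lone A) X Y = eps (X *' Y);
  coc_unit2 : forall X Y, Phi X (lone A) Y = eps (X *' Y);
  coc_unit3 : forall X Y, Phi X Y (lone A) = eps (X *' Y);
  coc_ract : forall X Y Z b, Phi X Y (ract Z b) = Phi X Y (ractbar Z b);
  coc_cocycle : forall X Y Z W,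
    \sum_(x <- cop2 X) \sum_(y <- cop2 Y) \sum_(z <- cop2 Z) \sum_(w <- cop2 W)
      Phi x.1 y.1 (z.1 *' w.1) * Phi (x.2 *' y.2) z.2 w.2 =
    \sum_(x <- cop2 X) \sum_(y <- iter_cop3 cop2 Y)
    \sum_(z <- iter_cop3 cop2 Z) \sum_(w <- cop2 W)
      let: (x1, x2) := x in let: (y1, y2, y3) := y in
      let: (z1, z2, z3) := z in let: (w1, w2) := w in
      Phi x1 (lact (Phi y1 z1 w1) (y2 *' z2)) w2 * Phi x2 y3 z3;
  coc_assoc : forall X Y Z,
    \sum_(x <- cop2 X) \sum_(y <- cop2 Y) \sum_(z <- cop2 Z)
      lact (Phi x.1 y.1 z.1) ((x.2 *' y.2) *' z.2) =
    \sum_(x <- cop2 X) \sum_(y <- cop2 Y) \sum_(z <- cop2 Z)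
      lactbar (Phi x.2 y.2 z.2) (x.1 *' (y.1 *' z.1))
}.

Record coquasi_bialgebroid_with (Phi : L -> L -> L -> B) : Prop :=
  CoquasiWith {
  cq_algebra : is_algebra_over;
  cq_compatible : is_compatible;
  cq_cocycle : normalised_cocycle3 Phi
}.

Definition coquasi_bialgebroid : Prop :=
  exists Phi, coquasi_bialgebroid_with Phi.

(* Associativity of the product is coc_assoc for Phi := eps3. *)
Definition bialgebroid : Prop := coquasi_bialgebroid_with eps3.

Record in_C2 (S : L -> L -> B) : Prop := InC2 {
  C2_hom : hom2 S;
  C2_unitl : forall X, S (lone A) X = eps X;
  C2_unitr : forall X, S X (lone A) = eps X;
  C2_inv : exists S', conv_inverse2 S S';
  C2_ract : forall X Y b, S X (ractbar Y b) = S X (ract Y b)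
}.

Definition coboundary_of (d : L -> seq (L * L)) (S S' : L -> L -> B)
    (X Y Z : L) : B :=
  \sum_(x <- iter_cop3 d X) \sum_(y <- iter_cop4 d Y) \sum_(z <- iter_cop3 d Z)
    let: (x1, x2, x3) := x in let: (y1, y2, y3, y4) := y in
    let: (z1, z2, z3) := z in
    S x1 (lact (S y1 z1) (y2 *' z2)) *
    S' (lactbar (S' x3 y4) (x2 *' y3)) z3.

Definition twist_mul_of (d : L -> seq (L * L)) (S S' : L -> L -> B)
    (X Y : L) : L :=
  \sum_(x <- iter_cop3 d X) \sum_(y <- iter_cop3 d Y)
    let: (x1, x2, x3) := x in let: (y1, y2, y3) := y in
    lact (S x1 y1) (lactbar (S' x3 y3) (x2 *' y2)).

Definition coboundary := coboundary_of cop2.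

Definition twist (S S' : L -> L -> B) : alg_data :=
  AlgData (lone A) (twist_mul_of cop2 S S') (lsrc A) (ltgt A).

End Sweedler.

(* Main.v *)
(** The left B^e-linear maps L (x)_{B^e} ... (x)_{B^e} L -> B form a convolution
    monoid, and for every left B^e-module M the maps to M form a bimodule over
    it.  The twisted product is m^S = S * m * S^{-1} in such a bimodule.  Writing
    w_{12}, w_{12,3}, w_{1,23}, w_{23} for the images of a 2-cochain w in the
    monoid of 3-cochains (w on the first two legs, w after multiplying two legs,
    w on the last two legs), the coboundary is
      S_{23} * S_{1,23} * S_{12,3}^{-1} * S_{12}^{-1},
    visibly invertible.  Precomposing with m^S on some legs is conjugation by the
    corresponding S after precomposing with m; hence quasi-associativity is a
    cancellation in the bimodule of maps L (x) L (x) L -> L, and the cocycle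
    identity is a cancellation in the monoid of 4-cochains, exactly as for the
    Drinfeld twist of a bialgebra. *)

From HB Require Import structures.
Require Import Defs.
From mathcomp Require Import all_boot all_algebra.
From mathcomp Require Import boolp.
From mathcomp.multinomials Require Import freeg.

Set Implicit Arguments.
Unset Strict Implicit.
Unset Printing Implicit Defensive.

Import GRing.Theory.
Local Open Scope ring_scope.

(** Over a noncommutative base the obstacle is to make sense of a cochain placed on some of the
    legs. The map w(X eps(Y)) must be balanced over B^e, so w(X \bar b eps(Y)) has to equal w(X
    eps(\bar b Y)) = w(X eps(Y) b). This holds as soon as w does not distinguish right
    multiplication by b from right multiplication by \bar b. That is the role of the last condition
    defining C^2, and the monoid used below consists of the cochains that satisfy it; the inverse of
    such a cochain is shown to satisfy it too. The same condition, combined with the Takeuchi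
    condition, moves the value of one cochain past another: u(X_1 v(Y_1)) F(X_2, Y_2) = u(X_1)
    F(X_2, v(Y_1) Y_2) in Sweedler sums. Thus the nested arguments in the formula for the coboundary
    are what a plain product of four factors looks like once it is written out. Convolution is
    developed for an abstract coalgebra C, and the tensor product of two such coalgebras is again
    one. Cochains in two, three and four variables are then instances of one theory. *)

Notation addmap f := {morph f : x y / x + y} (only parsing).

Lemma addmap0 (U V : zmodType) (f : U -> V) : addmap f -> f 0 = 0.
Proof. by move=> fD; apply: (addrI (f 0)); rewrite -fD !addr0. Qed.

Lemma addmap_sum (U V : zmodType) (f : U -> V) I (r : seq I) (F : I -> U) :
  addmap f -> f (\sum_(i <- r) F i) = \sum_(i <- r) f (F i).
Proof. by move=> fD; apply: big_morph => //; apply: addmap0. Qed.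

(** * Coalgebroids presented by generators *)

(* An abelian group with the four actions of B and \bar B, given through
   generators: [adm f] says that f extends to an additive map on the group.  A
   tensor product then needs no quotient: its generators are pairs, and the
   balancing relations go into [adm].  [la, lb, ra, rb] are the actions of b and
   \bar b from the left and from the right. *)
Record bispace (B : nzRingType) := Bispace {
  gens :> Type;
  la : B -> gens -> gens;
  lb : B -> gens -> gens;
  ra : gens -> B -> gens;
  rb : gens -> B -> gens;
  adm : forall G : zmodType, (gens -> G) -> Prop;
  adm_sum : forall (G : zmodType) I (r : seq I) (f : I -> gens -> G),
    (forall i, adm (f i)) -> adm (fun c => \sum_(i <- r) f i c);
  adm_comp : forall (G H : zmodType) (h : G -> H) (f : gens -> G),
    addmap h -> adm f -> adm (fun c => h (f c));
  adm_la : forall (G : zmodType) (f : gens -> G) b, adm f ->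
    adm (fun c => f (la b c));
  adm_lb : forall (G : zmodType) (f : gens -> G) b, adm f ->
    adm (fun c => f (lb b c));
  adm_ra : forall (G : zmodType) (f : gens -> G) b, adm f ->
    adm (fun c => f (ra c b));
  adm_rb : forall (G : zmodType) (f : gens -> G) b, adm f ->
    adm (fun c => f (rb c b));
  adm_laD : forall (G : zmodType) (f : gens -> G) c, adm f ->
    addmap (fun b => f (la b c));
  adm_lbD : forall (G : zmodType) (f : gens -> G) c, adm f ->
    addmap (fun b => f (lb b c));
  adm_raD : forall (G : zmodType) (f : gens -> G) c, adm f ->
    addmap (fun b => f (ra c b));
  adm_rbD : forall (G : zmodType) (f : gens -> G) c, adm f ->
    addmap (fun b => f (rb c b));
  laM : forall a b c, la (a * b) c = la a (la b c);
  lbM : forall a b c, lb (a * b) c = lb b (lb a c);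
  ra1 : forall c, ra c 1 = c;
  raM : forall c a b, ra c (a * b) = ra (ra c a) b;
  rbM : forall c a b, rb c (a * b) = rb (rb c b) a;
  la_lb : forall a b c, la a (lb b c) = lb b (la a c);
  la_ra : forall a c b, la a (ra c b) = ra (la a c) b;
  la_rb : forall a c b, la a (rb c b) = rb (la a c) b;
  lb_ra : forall a c b, lb a (ra c b) = ra (lb a c) b;
  lb_rb : forall a c b, lb a (rb c b) = rb (lb a c) b
}.

Section Balanced.
Variables (B : nzRingType) (C : bispace B) (G : zmodType).

Record bal2 (K : C -> C -> G) : Prop := Bal2 {
  bal2l : forall c', adm (K^~ c');
  bal2r : forall c, adm (K c);
  bal2b : forall b c c', K (lb b c) c' = K c (la b c')
}.

Record bal3 (K : C -> C -> C -> G) : Prop := Bal3 {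
  bal3_1 : forall c' c'', adm (fun c => K c c' c'');
  bal3_2 : forall c c'', adm (fun c' => K c c' c'');
  bal3_3 : forall c c', adm (K c c');
  bal3_12 : forall b c c' c'', K (lb b c) c' c'' = K c (la b c') c'';
  bal3_23 : forall b c c' c'', K c (lb b c') c'' = K c c' (la b c'')
}.

Lemma bal3_bal2 (K : C -> C -> C -> G) c : bal3 K -> bal2 (K c).
Proof. by case=> _ K2 K3 _ K23; split=> *; rewrite ?K23. Qed.

End Balanced.

(* The coproduct is a list of pairs that is only ever evaluated under balanced
   maps.  [cop_tak] is the Takeuchi condition; [cop_ra], [cop_rb] and [cou_rab]
   hold in a left bialgebroid and are what the tensor product requires. *)
Record coalg (B : nzRingType) := Coalg {
  bisp :> bispace B;
  cop : bisp -> seq (bisp * bisp);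
  cou : bisp -> B;
  cop_adm : forall (G : zmodType) (K : bisp -> bisp -> G), bal2 K ->
    adm (fun c => \sum_(x <- cop c) K x.1 x.2);
  cop_la : forall (G : zmodType) (K : bisp -> bisp -> G) b c, bal2 K ->
    \sum_(x <- cop (la b c)) K x.1 x.2 = \sum_(x <- cop c) K (la b x.1) x.2;
  cop_lb : forall (G : zmodType) (K : bisp -> bisp -> G) b c, bal2 K ->
    \sum_(x <- cop (lb b c)) K x.1 x.2 = \sum_(x <- cop c) K x.1 (lb b x.2);
  cop_ra : forall (G : zmodType) (K : bisp -> bisp -> G) c b, bal2 K ->
    \sum_(x <- cop (ra c b)) K x.1 x.2 = \sum_(x <- cop c) K (ra x.1 b) x.2;
  cop_rb : forall (G : zmodType) (K : bisp -> bisp -> G) c b, bal2 K ->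
    \sum_(x <- cop (rb c b)) K x.1 x.2 = \sum_(x <- cop c) K x.1 (rb x.2 b);
  cop_tak : forall (G : zmodType) (K : bisp -> bisp -> G) c b, bal2 K ->
    \sum_(x <- cop c) K (rb x.1 b) x.2 = \sum_(x <- cop c) K x.1 (ra x.2 b);
  copA : forall (G : zmodType) (K : bisp -> bisp -> bisp -> G) c, bal3 K ->
    \sum_(x <- cop c) \sum_(y <- cop x.1) K y.1 y.2 x.2 =
    \sum_(x <- cop c) \sum_(y <- cop x.2) K x.1 y.1 y.2;
  cou_adm : adm cou;
  cou_la : forall b c, cou (la b c) = b * cou c;
  cou_lb : forall b c, cou (lb b c) = cou c * b;
  cou_rab : forall c b, cou (ra c b) = cou (rb c b);
  couL : forall (G : zmodType) (f : bisp -> G) c, adm f ->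
    \sum_(x <- cop c) f (la (cou x.1) x.2) = f c;
  couR : forall (G : zmodType) (f : bisp -> G) c, adm f ->
    \sum_(x <- cop c) f (lb (cou x.2) x.1) = f c
}.

(** * Tensor products over B^e as coalgebras *)

Section Tensor.
Variables (B : nzRingType) (C D : coalg B).

Record tens_adm (G : zmodType) (f : C * D -> G) : Prop := TensAdm {
  tens_adml : forall d, adm (fun c => f (c, d));
  tens_admr : forall c, adm (fun d => f (c, d));
  tens_bal : forall c b d, f (ra c b, d) = f (c, la b d);
  tens_balbar : forall c b d, f (rb c b, d) = f (c, lb b d)
}.

Definition tens_la (b : B) (p : C * D) : C * D := (la b p.1, p.2).
Definition tens_lb (b : B) (p : C * D) : C * D := (lb b p.1, p.2).
Definition tens_ra (p : C * D) (b : B) : C * D := (p.1, ra p.2 b).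
Definition tens_rb (p : C * D) (b : B) : C * D := (p.1, rb p.2 b).

Definition tens_bispace : bispace B.
Proof.
refine (@Bispace B (C * D)%type tens_la tens_lb tens_ra tens_rb tens_adm
  _ _ _ _ _ _ _ _ _ _ _ _ _ _ _ _ _ _ _ _).
- move=> G I r f fP; split=> [d|c|c b d|c b d].
  + by apply: adm_sum => i; case: (fP i).
  + by apply: adm_sum => i; case: (fP i).
  + by apply: eq_bigr => i _; apply: tens_bal.
  + by apply: eq_bigr => i _; apply: tens_balbar.
- move=> G H h f hD [f1 f2 f3 f4]; split=> [d|c|c b d|c b d].
  + exact: adm_comp (f1 d).
  + exact: adm_comp (f2 c).
  + by rewrite f3.
  + by rewrite f4.
- move=> G f b [f1 f2 f3 f4]; rewrite /tens_la; split=> [d|c|c a d|c a d] /=.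
  + exact: (adm_la (f := fun c => f (c, d))).
  + exact: f2.
  + by rewrite la_ra f3.
  + by rewrite la_rb f4.
- move=> G f b [f1 f2 f3 f4]; rewrite /tens_lb; split=> [d|c|c a d|c a d] /=.
  + exact: (adm_lb (f := fun c => f (c, d))).
  + exact: f2.
  + by rewrite lb_ra f3.
  + by rewrite lb_rb f4.
- move=> G f b [f1 f2 f3 f4]; rewrite /tens_ra; split=> [d|c|c a d|c a d] /=.
  + exact: f1.
  + exact: (adm_ra (f := fun d => f (c, d))).
  + by rewrite f3 la_ra.
  + by rewrite f4 lb_ra.
- move=> G f b [f1 f2 f3 f4]; rewrite /tens_rb; split=> [d|c|c a d|c a d] /=.
  + exact: f1.
  + exact: (adm_rb (f := fun d => f (c, d))).
  + by rewrite f3 la_rb.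
  + by rewrite f4 lb_rb.
- by move=> G f [c d] [f1 _ _ _] x y; apply: (adm_laD (f := fun c => f (c, d))).
- by move=> G f [c d] [f1 _ _ _] x y; apply: (adm_lbD (f := fun c => f (c, d))).
- by move=> G f [c d] [_ f2 _ _] x y; apply: (adm_raD (f := fun d => f (c, d))).
- by move=> G f [c d] [_ f2 _ _] x y; apply: (adm_rbD (f := fun d => f (c, d))).
- by move=> a b [c d]; rewrite /tens_la laM.
- by move=> a b [c d]; rewrite /tens_lb lbM.
- by move=> [c d]; rewrite /tens_ra ra1.
- by move=> [c d] a b; rewrite /tens_ra raM.
- by move=> [c d] a b; rewrite /tens_rb rbM.
- by move=> a b [c d]; rewrite /tens_la /tens_lb la_lb.
- by [].
- by [].
- by [].
- by [].
Defined.

Local Notation T := tens_bispace.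

(** The coproduct of the first factor is summed inside: only the completed inner sum is balanced in
    the legs of the second factor. *)
Definition tens_cop (p : T) : seq (T * T) :=
  [seq ((x.1, y.1), (x.2, y.2)) | y <- cop p.2, x <- cop p.1].

(** The axiom eps(X eps(Y)) = eps(XY) dictates this formula: with it the product of a left
    bialgebroid preserves counits. *)
Definition tens_cou (p : T) : B := cou (ra p.1 (cou p.2)).

Lemma tens_copE (G : zmodType) (F : T -> T -> G) p :
  \sum_(z <- tens_cop p) F z.1 z.2 =
  \sum_(y <- cop p.2) \sum_(x <- cop p.1) F (x.1, y.1) (x.2, y.2).
Proof. exact: big_allpairs_dep. Qed.

Lemma tens_bal2l (G : zmodType) (K : T -> T -> G) d d' :
  bal2 K -> bal2 (fun c c' : C => K (c, d) (c', d')).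
Proof.
case=> Kl Kr Kb; split=> [c'|c|b c c'].
- exact: tens_adml (Kl _) d.
- exact: tens_adml (Kr _) d'.
- exact: Kb b (c, d) (c', d').
Qed.

(* Balancedness in the second factor only holds after summing over the
   coproduct of the first one, through the Takeuchi condition there. *)
Lemma tens_bal2r (G : zmodType) (K : T -> T -> G) c : bal2 K ->
  bal2 (fun d d' : D => \sum_(x <- cop c) K (x.1, d) (x.2, d')).
Proof.
move=> KP; case: (KP) => Kl Kr Kb; split=> [d'|d|b d d'].
- by apply: adm_sum => x; apply: tens_admr (Kl _) _.
- by apply: adm_sum => x; apply: tens_admr (Kr _) _.
- transitivity (\sum_(x <- cop c) K (rb x.1 b, d) (x.2, d')).
    by apply: eq_bigr => x _; rewrite (tens_balbar (Kl _)).
  rewrite (cop_tak (K := fun c c' => K (c, d) (c', d'))); last first.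
    exact: tens_bal2l.
  by apply: eq_bigr => x _; rewrite (tens_bal (Kr _)).
Qed.

Lemma tens_bal3l (G : zmodType) (K : T -> T -> T -> G) d d' d'' :
  bal3 K -> bal3 (fun c c' c'' : C => K (c, d) (c', d') (c'', d'')).
Proof.
case=> K1 K2 K3 K12 K23; split=> [c' c''|c c''|c c'|b c c' c''|b c c' c''].
- exact: tens_adml (K1 _ _) d.
- exact: tens_adml (K2 _ _) d'.
- exact: tens_adml (K3 _ _) d''.
- exact: K12 b (c, d) (c', d') (c'', d'').
- exact: K23 b (c, d) (c', d') (c'', d'').
Qed.

Lemma tens_bal3r (G : zmodType) (K : T -> T -> T -> G) c : bal3 K ->
  bal3 (fun d d' d'' : D => \sum_(x <- cop c) \sum_(x' <- cop x.2)
    K (x.1, d) (x'.1, d') (x'.2, d'')).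
Proof.
move=> KP; case: (KP) => K1 K2 K3 K12 K23.
split=> [d' d''|d d''|d d'|b d d' d''|b d d' d''].
- by do 2!(apply: adm_sum => ?); apply: tens_admr (K1 _ _) _.
- by do 2!(apply: adm_sum => ?); apply: tens_admr (K2 _ _) _.
- by do 2!(apply: adm_sum => ?); apply: tens_admr (K3 _ _) _.
(* [H] is the inner sum. Takeuchi for the outer coproduct turns \bar b on the first leg into b on
   the second, and [cop_ra] passes it to the first leg of the inner coproduct, where it crosses the
   tensor sign. *)
- pose H (c c' : C) :=
    \sum_(x' <- cop c') K (c, d) (x'.1, d') (x'.2, d'').
  have K'P c1 : bal2 (fun c' c'' : C => K (c1, d) (c', d') (c'', d'')).
    exact: (bal3_bal2 c1 (tens_bal3l d d' d'' KP)).
  have HP : bal2 H.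
    split=> [c'|c1|a c1 c'].
    + by apply: adm_sum => x; apply: tens_adml (K1 _ _) d.
    + exact: cop_adm (K'P c1).
    + rewrite /H (cop_la _ _ (K'P c1)); apply: eq_bigr => x _.
      exact: K12 a (c1, d) (x.1, d') (x.2, d'').
  transitivity (\sum_(x <- cop c) H (rb x.1 b) x.2).
    by do 2!(apply: eq_bigr => ? _); rewrite (tens_balbar (K1 _ _)).
  rewrite (cop_tak _ _ HP); apply: eq_bigr => x _.
  rewrite /H (cop_ra _ _ (K'P _)); apply: eq_bigr => x' _.
  by rewrite (tens_bal (K2 _ _)).
- apply: eq_bigr => x _.
  pose H (c' c'' : C) := K (x.1, d) (c', d') (c'', d'').
  have HP : bal2 H := bal3_bal2 x.1 (tens_bal3l d d' d'' KP).
  transitivity (\sum_(x' <- cop x.2) H (rb x'.1 b) x'.2).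
    by apply: eq_bigr => ? _; rewrite /H (tens_balbar (K2 _ _)).
  rewrite (cop_tak _ _ HP); apply: eq_bigr => x' _.
  by rewrite /H (tens_bal (K3 _ _)).
Qed.

(** Inside the counit e may be replaced by \bar e; the Takeuchi condition moves it to the other leg,
    the counit law collapses the coproduct, and e crosses the tensor sign. This reduces the counit
    law of the tensor product to that of its second factor. *)
Lemma cou_absorbl (G : zmodType) (f : T -> G) c d e : adm f ->
  \sum_(x <- cop c) f (la (cou (ra x.1 e)) x.2, d) = f (c, la e d).
Proof.
move=> fP; pose K (c c' : C) := f (la (cou c) c', d).
have f1 : adm (fun c => f (c, d)) by apply: tens_adml.
have KP : bal2 K.
  split=> [c'|c1|b c1 c'].
  - by apply: (adm_comp (h := fun b => f (la b c', d))) (cou_adm C) => x y;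
      apply: adm_laD f1 x y.
  - exact: adm_la f1.
  - by rewrite /K cou_lb laM.
transitivity (\sum_(x <- cop c) K (rb x.1 e) x.2).
  by apply: eq_bigr => x _; rewrite /K cou_rab.
rewrite (cop_tak _ _ KP).
transitivity (\sum_(x <- cop c) f (ra (la (cou x.1) x.2) e, d)).
  by apply: eq_bigr => x _; rewrite /K la_ra.
rewrite (couL (f := fun c' => f (ra c' e, d))); last exact: adm_ra f1.
exact: (tens_bal fP).
Qed.

Lemma cou_absorbr (G : zmodType) (f : T -> G) c d e : adm f ->
  \sum_(x <- cop c) f (lb (cou (ra x.2 e)) x.1, d) = f (c, lb e d).
Proof.
move=> fP; pose K (c c' : C) := f (lb (cou c') c, d).
have f1 : adm (fun c => f (c, d)) by apply: tens_adml.
have KP : bal2 K.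
  split=> [c'|c1|b c1 c'].
  - exact: adm_lb f1.
  - by apply: (adm_comp (h := fun b => f (lb b c1, d))) (cou_adm C) => x y;
      apply: adm_lbD f1 x y.
  - by rewrite /K cou_la lbM.
transitivity (\sum_(x <- cop c) K x.1 (ra x.2 e)) => //.
rewrite -(cop_tak _ _ KP).
transitivity (\sum_(x <- cop c) f (rb (lb (cou x.2) x.1) e, d)).
  by apply: eq_bigr => x _; rewrite /K lb_rb.
rewrite (couR (f := fun c' => f (rb c' e, d))); last exact: adm_rb f1.
exact: (tens_balbar fP).
Qed.

Definition tens : coalg B.
Proof.
refine (@Coalg B T tens_cop tens_cou _ _ _ _ _ _ _ _ _ _ _ _ _).
- move=> G K KP; pose J c (d d' : D) := \sum_(x <- cop c) K (x.1, d) (x.2, d').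
  have JP c : bal2 (J c) by apply: tens_bal2r.
  rewrite (_ : (fun _ => _) = (fun p : T => \sum_(y <- cop p.2) J p.1 y.1 y.2));
    last by apply: funext => p; rewrite tens_copE.
  split=> [d|c|c b d|c b d] /=.
  + apply: adm_sum => y.
    exact: (cop_adm (K := fun c c' => K (c, y.1) (c', y.2))) (tens_bal2l _ _ KP).
  + exact: cop_adm.
  + rewrite (cop_la _ _ (JP c)); apply: eq_bigr => y _.
    rewrite /J (cop_ra _ _ (tens_bal2l y.1 y.2 KP)); apply: eq_bigr => x _.
    by rewrite (tens_bal (bal2l KP _)).
  + rewrite (cop_lb _ _ (JP c)); apply: eq_bigr => y _.
    rewrite /J (cop_rb _ _ (tens_bal2l y.1 y.2 KP)); apply: eq_bigr => x _.
    by rewrite (tens_balbar (bal2r KP _)).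
- move=> G K b [c d] KP; rewrite tens_copE.
  rewrite [RHS](tens_copE (fun z => K (la b z))).
  by apply: eq_bigr => y _; apply: (cop_la _ _ (tens_bal2l y.1 y.2 KP)).
- move=> G K b [c d] KP; rewrite tens_copE.
  rewrite [RHS](tens_copE (fun z z' => K z (lb b z'))).
  by apply: eq_bigr => y _; apply: (cop_lb _ _ (tens_bal2l y.1 y.2 KP)).
- move=> G K [c d] b KP; rewrite tens_copE.
  rewrite [RHS](tens_copE (fun z => K (ra z b))).
  exact: (cop_ra _ _ (tens_bal2r c KP)).
- move=> G K [c d] b KP; rewrite tens_copE.
  rewrite [RHS](tens_copE (fun z z' => K z (rb z' b))).
  exact: (cop_rb _ _ (tens_bal2r c KP)).
- move=> G K [c d] b KP.
  rewrite (tens_copE (fun z => K (rb z b))).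
  rewrite [RHS](tens_copE (fun z z' => K z (ra z' b))).
  exact: (cop_tak _ _ (tens_bal2r c KP)).
(* With the coproducts of d outermost, coassociativity of the first factor applies for fixed legs of
   d; the resulting sum over legs of c is balanced in the legs of d, so coassociativity of the
   second factor applies to it. *)
- move=> G K [c d] KP.
  rewrite (tens_copE (fun z z' => \sum_(y <- tens_cop z) K y.1 y.2 z')).
  rewrite [RHS](tens_copE (fun z z' => \sum_(y <- tens_cop z') K z y.1 y.2)).
  transitivity (\sum_(y <- cop d) \sum_(y' <- cop y.1) \sum_(x <- cop c)
      \sum_(x' <- cop x.1) K (x'.1, y'.1) (x'.2, y'.2) (x.2, y.2)).
    apply: eq_bigr => y _; rewrite exchange_big; apply: eq_bigr => x _ /=.
    by rewrite (tens_copE (fun z z' => K z z' _)).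
  rewrite -[LHS]/(\sum_(y <- cop d) \sum_(y' <- cop y.1)
     (fun y1 y2 y3 => \sum_(x <- cop c) \sum_(x' <- cop x.1)
        K (x'.1, y1) (x'.2, y2) (x.2, y3)) y'.1 y'.2 y.2).
  under eq_bigr do under eq_bigr do rewrite (copA _ (tens_bal3l _ _ _ KP)).
  rewrite (copA _ (tens_bal3r c KP)); apply: eq_bigr => y _.
  rewrite exchange_big; apply: eq_bigr => x _ /=.
  by rewrite (tens_copE (K _)).
- split=> [d|c|c b d|c b d]; rewrite /tens_cou /=.
  + by apply: adm_ra; apply: cou_adm.
  + by apply: (adm_comp (h := fun b => cou (ra c b))) (cou_adm D) => x y;
      apply: adm_raD (cou_adm C) x y.
  + by rewrite cou_la raM.
  + by rewrite cou_rab -rbM -cou_rab cou_lb.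
- by move=> b [c d]; rewrite /tens_cou /= -la_ra cou_la.
- by move=> b [c d]; rewrite /tens_cou /= -lb_ra cou_lb.
- by move=> [c d] b; rewrite /tens_cou /= (cou_rab d).
- move=> G f [c d] fP; rewrite (tens_copE (fun z z' => f (la (tens_cou z) z'))).
  transitivity (\sum_(y <- cop d) f (c, la (cou y.1) y.2)).
    by apply: eq_bigr => y _; apply: (cou_absorbl c y.2 (cou y.1) fP).
  exact: (couL (f := fun d => f (c, d))) (tens_admr fP c).
- move=> G f [c d] fP; rewrite (tens_copE (fun z z' => f (lb (tens_cou z') z))).
  transitivity (\sum_(y <- cop d) f (c, lb (cou y.2) y.1)).
    by apply: eq_bigr => y _; apply: (cou_absorbr c y.1 (cou y.2) fP).
  exact: (couR (f := fun d => f (c, d))) (tens_admr fP c).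
Defined.

End Tensor.

Notation "C ** D" := (tens C D) (at level 40, left associativity).

(** * The convolution monoid and its bimodules *)

(** Left B^e-modules, the targets of cochains. Three are used: B for the cochains proper, L for
    products, and the diamond square of L for coproducts. *)
Record bmod (B : nzRingType) := Bmod {
  mcar :> zmodType;
  mla : B -> mcar -> mcar;
  mlb : B -> mcar -> mcar;
  mlaDl : forall m, addmap (mla^~ m);
  mlaDr : forall b, addmap (mla b);
  mlbDl : forall m, addmap (mlb^~ m);
  mlbDr : forall b, addmap (mlb b);
  mlaM : forall a b m, mla (a * b) m = mla a (mla b m);
  mlbM : forall a b m, mlb (a * b) m = mlb b (mlb a m);
  mla_mlb : forall a b m, mla a (mlb b m) = mlb b (mla a m)
}.

Definition breg (B : nzRingType) : bmod B.
Proof.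
refine (@Bmod B B (fun b x => b * x) (fun b x => x * b) _ _ _ _ _ _ _).
- by move=> m x y; rewrite mulrDl.
- by move=> b x y; rewrite mulrDr.
- by move=> m x y; rewrite mulrDr.
- by move=> b x y; rewrite mulrDl.
- by move=> a b m; rewrite mulrA.
- by move=> a b m; rewrite mulrA.
- by move=> a b m; rewrite mulrA.
Defined.

Record hom (B : nzRingType) (C : bispace B) (M : bmod B) := Hom {
  hfun :> C -> M;
  h_adm : adm hfun;
  h_la : forall b c, hfun (la b c) = mla b (hfun c);
  h_lb : forall b c, hfun (lb b c) = mlb b (hfun c)
}.

Lemma hom_eq (B : nzRingType) (C : bispace B) (M : bmod B) (F G : hom C M) :
  F =1 G -> F = G.
Proof.
case: F G => [f f1 f2 f3] [g g1 g2 g3] /= /funext fg.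
by case: _ / fg in g1 g2 g3 *; congr Hom; apply: Prop_irrelevance.
Qed.

Section Convolution.
Variables (B : nzRingType) (C : coalg B).
Implicit Type M : bmod B.
Local Notation R := (breg B).

Lemma adm_mlal M (f : hom C R) (m : M) : adm (fun c => mla (f c) m).
Proof.
exact: (@adm_comp B C R M (fun b : B => mla b m) f (mlaDl m) (h_adm f)).
Qed.

Lemma adm_mlbl M (f : hom C R) (m : M) : adm (fun c => mlb (f c) m).
Proof.
exact: (@adm_comp B C R M (fun b : B => mlb b m) f (mlbDl m) (h_adm f)).
Qed.

Lemma adm_mlar M b (F : C -> M) : adm F -> adm (fun c => mla b (F c)).
Proof. exact: (@adm_comp B C M M (mla b) F (mlaDr b)). Qed.

Lemma adm_mlbr M b (F : C -> M) : adm F -> adm (fun c => mlb b (F c)).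
Proof. exact: (@adm_comp B C M M (mlb b) F (mlbDr b)). Qed.

Lemma lconv_bal2 M (f : hom C R) (F : hom C M) :
  bal2 (fun c c' => mla (f c) (F c')).
Proof.
split=> [c'|c|b c c'].
- exact: adm_mlal.
- exact: adm_mlar (h_adm F).
- by rewrite h_lb h_la -mlaM.
Qed.

Lemma rconv_bal2 M (F : hom C M) (f : hom C R) :
  bal2 (fun c c' => mlb (f c') (F c)).
Proof.
split=> [c'|c|b c c'].
- exact: adm_mlbr (h_adm F).
- exact: adm_mlbl.
- by rewrite h_lb h_la -mlbM.
Qed.

Definition lconv M (f : hom C R) (F : hom C M) : hom C M.
Proof.
refine (@Hom _ C M (fun c => \sum_(x <- cop c) mla (f x.1) (F x.2)) _ _ _).
- exact: cop_adm (lconv_bal2 f F).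
- move=> b c; rewrite (cop_la _ _ (lconv_bal2 f F)).
  rewrite (addmap_sum _ _ (mlaDr b)).
  by apply: eq_bigr => x _; rewrite h_la mlaM.
- move=> b c; rewrite (cop_lb _ _ (lconv_bal2 f F)).
  rewrite (addmap_sum _ _ (mlbDr b)).
  by apply: eq_bigr => x _; rewrite h_lb mla_mlb.
Defined.

Definition rconv M (F : hom C M) (f : hom C R) : hom C M.
Proof.
refine (@Hom _ C M (fun c => \sum_(x <- cop c) mlb (f x.2) (F x.1)) _ _ _).
- exact: cop_adm (rconv_bal2 F f).
- move=> b c; rewrite (cop_la _ _ (rconv_bal2 F f)).
  rewrite (addmap_sum _ _ (mlaDr b)).
  by apply: eq_bigr => x _; rewrite h_la mla_mlb.
- move=> b c; rewrite (cop_lb _ _ (rconv_bal2 F f)).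
  rewrite (addmap_sum _ _ (mlbDr b)).
  by apply: eq_bigr => x _; rewrite h_lb mlbM.
Defined.

Definition hcou : hom C R :=
  @Hom _ C R (@cou B C) (cou_adm C) (@cou_la B C) (@cou_lb B C).

(** On B the action of \bar b is right multiplication by b, so both module structures restrict to
    the convolution product. *)
Lemma rconvR (f g : hom C R) : rconv f g = lconv f g.
Proof. exact: hom_eq. Qed.

Lemma lconv1 M (F : hom C M) : lconv hcou F = F.
Proof.
apply: hom_eq => c /=; rewrite -[RHS](couL _ (h_adm F)).
by apply: eq_bigr => x _; rewrite h_la.
Qed.

Lemma rconv1 M (F : hom C M) : rconv F hcou = F.
Proof.
apply: hom_eq => c /=; rewrite -[RHS](couR _ (h_adm F)).
by apply: eq_bigr => x _; rewrite h_lb.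
Qed.

Lemma trilin_bal3 M (f g : hom C R) (F : hom C M) :
  [/\ bal3 (fun c c' c'' => mla (f c) (mla (g c') (F c''))),
      bal3 (fun c c' c'' => mla (f c) (mlb (g c'') (F c')))
    & bal3 (fun c c' c'' => mlb (g c'') (mlb (f c') (F c)))].
Proof.
have FA := h_adm F.
by split; split=> *; rewrite ?h_la ?h_lb /= ?mlaM ?mlbM ?mla_mlb //;
  auto using adm_mlal, adm_mlbl, adm_mlar, adm_mlbr.
Qed.

Lemma lconvA M (f g : hom C R) (F : hom C M) :
  lconv (lconv f g) F = lconv f (lconv g F).
Proof.
apply: hom_eq => c /=; have [P _ _] := trilin_bal3 f g F.
transitivity (\sum_(x <- cop c) \sum_(y <- cop x.1)
  mla (f y.1) (mla (g y.2) (F x.2))).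
  apply: eq_bigr => x _; rewrite (addmap_sum _ _ (mlaDl (F x.2))).
  by apply: eq_bigr => y _; rewrite mlaM.
rewrite (copA _ P); apply: eq_bigr => x _.
by rewrite (addmap_sum _ _ (mlaDr _)).
Qed.

Lemma lrconv M (f g : hom C R) (F : hom C M) :
  lconv f (rconv F g) = rconv (lconv f F) g.
Proof.
apply: hom_eq => c /=; have [_ P _] := trilin_bal3 f g F.
transitivity (\sum_(x <- cop c) \sum_(y <- cop x.2)
  mla (f x.1) (mlb (g y.2) (F y.1))).
  by apply: eq_bigr => x _; rewrite (addmap_sum _ _ (mlaDr _)).
rewrite -(copA _ P); apply: eq_bigr => x _.
rewrite (addmap_sum _ _ (mlbDr _)).
by apply: eq_bigr => y _; rewrite mla_mlb.
Qed.

Lemma rconvA M (f g : hom C R) (F : hom C M) :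
  rconv F (lconv f g) = rconv (rconv F f) g.
Proof.
apply: hom_eq => c /=; have [_ _ P] := trilin_bal3 f g F.
transitivity (\sum_(x <- cop c) \sum_(y <- cop x.2)
  mlb (g y.2) (mlb (f y.1) (F x.1))).
  apply: eq_bigr => x _; rewrite (addmap_sum _ _ (mlbDl (F x.1))).
  by apply: eq_bigr => y _; rewrite mlbM.
rewrite -(copA _ P); apply: eq_bigr => x _.
by rewrite (addmap_sum _ _ (mlbDr _)).
Qed.

(* Written with [ra] and [rb], the condition S(X, Y \bar b) = S(X, Y b). *)
Definition good (f : hom C R) := forall c b, f (ra c b) = f (rb c b).

Lemma good_cou : good hcou.
Proof. exact: cou_rab. Qed.

(** The coproduct puts right multiplication by b on the first leg and by \bar b on the second. To
    bring b to the second leg it is exchanged for \bar b under f and then moved by the Takeuchi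
    condition. *)
Lemma lconv_ra M (f : hom C R) (F : hom C M) c b : good f ->
  lconv f F (ra c b) = \sum_(x <- cop c) mla (f x.1) (F (ra x.2 b)).
Proof.
move=> fb; rewrite /= (cop_ra _ _ (lconv_bal2 f F)).
rewrite -(cop_tak _ _ (lconv_bal2 f F)).
by apply: eq_bigr => x _; rewrite fb.
Qed.

Lemma lconv_rb M (f : hom C R) (F : hom C M) c b :
  lconv f F (rb c b) = \sum_(x <- cop c) mla (f x.1) (F (rb x.2 b)).
Proof. exact: cop_rb (lconv_bal2 f F). Qed.

Lemma rconv_ra M (f : hom C R) (F : hom C M) c b :
  rconv F f (ra c b) = \sum_(x <- cop c) mlb (f x.2) (F (ra x.1 b)).
Proof. exact: cop_ra (rconv_bal2 F f). Qed.

Lemma rconv_rb M (f : hom C R) (F : hom C M) c b : good f ->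
  rconv F f (rb c b) = \sum_(x <- cop c) mlb (f x.2) (F (rb x.1 b)).
Proof.
move=> fb; rewrite /= (cop_rb _ _ (rconv_bal2 F f)).
rewrite (cop_tak _ _ (rconv_bal2 F f)).
by apply: eq_bigr => x _; rewrite fb.
Qed.

Lemma good_lconv (f g : hom C R) : good f -> good g -> good (lconv f g).
Proof.
move=> fb gb c b; rewrite lconv_ra // lconv_rb.
by apply: eq_bigr => x _; rewrite gb.
Qed.

Definition hom_ra M (F : hom C M) (b : B) : hom C M.
Proof.
refine (@Hom _ C M (fun c => F (ra c b)) (adm_ra _ (h_adm F)) _ _) => a c.
- by rewrite -la_ra h_la.
- by rewrite -lb_ra h_lb.
Defined.

Definition hom_rb M (F : hom C M) (b : B) : hom C M.
Proof.
refine (@Hom _ C M (fun c => F (rb c b)) (adm_rb _ (h_adm F)) _ _) => a c.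
- by rewrite -la_rb h_la.
- by rewrite -lb_rb h_lb.
Defined.

(* g(_ b) and g(_ \bar b) have the same right convolution product with f. *)
Lemma good_inv (f g : hom C R) :
  good f -> lconv f g = hcou -> lconv g f = hcou -> good g.
Proof.
move=> fb fg gf c b; rewrite -[LHS]/(hom_ra g b c) -[RHS]/(hom_rb g b c).
rewrite -(rconv1 (hom_ra g b)) -(rconv1 (hom_rb g b)) -fg !rconvA.
congr (hfun (rconv _ g) c).
apply: hom_eq => d; transitivity (rconv g f (ra d b)); last first.
  transitivity (rconv g f (rb d b)); last by rewrite rconv_rb.
  by rewrite rconvR gf; apply: good_cou.
by rewrite rconv_ra.
Qed.

(** The restriction to [good] maps is what allows a cochain to be extended by the counit to further
    legs. *)
Record dual := Dual { dfun :> hom C R; dualP : good dfun }.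

Lemma dual_eq (u v : dual) : u =1 v -> u = v.
Proof.
case: u v => [f f1] [g g1] /= fg1; have fg := @hom_eq _ _ R f g fg1.
by case: _ / fg in g1 *; congr Dual; apply: Prop_irrelevance.
Qed.

Definition dmul (u v : dual) := Dual (good_lconv (dualP u) (dualP v)).
Definition dunit := Dual good_cou.

Lemma lconv_dmul M (u v : dual) (F : hom C M) :
  lconv (dmul u v) F = lconv u (lconv v F).
Proof. exact: lconvA. Qed.

Lemma rconv_dmul M (u v : dual) (F : hom C M) :
  rconv F (dmul u v) = rconv (rconv F u) v.
Proof. exact: rconvA. Qed.

Lemma dmulA : associative dmul.
Proof.
move=> u v w; apply: dual_eq => c.
by rewrite -[LHS]/(lconv u (lconv v w) c) -lconvA.
Qed.

Lemma dmul1 : left_id dunit dmul.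
Proof.
by move=> u; apply: dual_eq => c; rewrite -[LHS]/(lconv hcou u c) lconv1.
Qed.

Lemma dmulr1 : right_id dunit dmul.
Proof.
move=> u; apply: dual_eq => c.
by rewrite -[LHS]/(lconv u hcou c) -rconvR rconv1.
Qed.

End Convolution.

(** * Morphisms *)

(* Compatibility with the actions is only required under admissible maps, so
   that c |-> (1, c) is a morphism C -> L ** C. *)
Record cmor (B : nzRingType) (C D : coalg B) := Cmor {
  cfun :> C -> D;
  c_adm : forall (G : zmodType) (f : D -> G), adm f ->
    adm (fun c => f (cfun c));
  c_la : forall (G : zmodType) (f : D -> G) b c, adm f ->
    f (cfun (la b c)) = f (la b (cfun c));
  c_lb : forall (G : zmodType) (f : D -> G) b c, adm f ->
    f (cfun (lb b c)) = f (lb b (cfun c));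
  c_ra : forall (G : zmodType) (f : D -> G) c b, adm f ->
    f (cfun (ra c b)) = f (ra (cfun c) b);
  c_rb : forall (G : zmodType) (f : D -> G) c b, adm f ->
    f (cfun (rb c b)) = f (rb (cfun c) b);
  c_cop : forall (G : zmodType) (K : D -> D -> G) c, bal2 K ->
    \sum_(x <- cop (cfun c)) K x.1 x.2 =
    \sum_(x <- cop c) K (cfun x.1) (cfun x.2);
  c_cou : forall c, cou (cfun c) = cou c
}.

Section Morphisms.
Variable B : nzRingType.
Implicit Types (C D E : coalg B) (M : bmod B).
Local Notation R := (breg B).

Lemma bal2_pull C D (f : cmor C D) (G : zmodType) (K : D -> D -> G) :
  bal2 K -> bal2 (fun c c' => K (f c) (f c')).
Proof.
case=> Kl Kr Kb; split=> [c'|c|b c c'].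
- exact: c_adm (Kl _).
- exact: c_adm (Kr _).
- rewrite (c_lb f b c (Kl _)).
  by rewrite (c_la f b c' (Kr _)) Kb.
Qed.

Definition idmor C : cmor C C.
Proof. by refine (@Cmor B C C id _ _ _ _ _ _ _). Defined.

Definition cmor_comp C D E (g : cmor D E) (f : cmor C D) : cmor C E.
Proof.
refine (@Cmor B C E (fun c => g (f c)) _ _ _ _ _ _ _).
- by move=> G h hP; apply: (c_adm f (c_adm g hP)).
- by move=> G h b c hP; rewrite (c_la f b c (c_adm g hP)) c_la.
- by move=> G h b c hP; rewrite (c_lb f b c (c_adm g hP)) c_lb.
- by move=> G h c b hP; rewrite (c_ra f c b (c_adm g hP)) c_ra.
- by move=> G h c b hP; rewrite (c_rb f c b (c_adm g hP)) c_rb.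
- by move=> G K c KP; rewrite c_cop // (c_cop _ _ (bal2_pull g KP)).
- by move=> c; rewrite !c_cou.
Defined.

Definition pull C D M (f : cmor C D) (F : hom D M) : hom C M.
Proof.
refine (@Hom _ C M (fun c => F (f c)) (c_adm f (h_adm F)) _ _) => b c.
- by rewrite (c_la f b c (h_adm F)) h_la.
- by rewrite (c_lb f b c (h_adm F)) h_lb.
Defined.

Lemma pullE C D M (f : cmor C D) (F : hom D M) c : pull f F c = F (f c).
Proof. by []. Qed.

Lemma pull_lconv C D M (f : cmor C D) u (F : hom D M) :
  pull f (lconv u F) = lconv (pull f u) (pull f F).
Proof. by apply: hom_eq => c /=; rewrite (c_cop _ _ (lconv_bal2 u F)). Qed.

Lemma pull_rconv C D M (f : cmor C D) u (F : hom D M) :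
  pull f (rconv F u) = rconv (pull f F) (pull f u).
Proof. by apply: hom_eq => c /=; rewrite (c_cop _ _ (rconv_bal2 F u)). Qed.

Lemma good_pull C D (f : cmor C D) (u : dual D) : good (pull f u).
Proof.
move=> c b; rewrite /= (c_ra f c b (h_adm u)) (c_rb f c b (h_adm u)).
exact: (dualP u).
Qed.

Definition dpull C D (f : cmor C D) (u : dual D) := Dual (good_pull f u).

Lemma dpullE C D (f : cmor C D) (u : dual D) c : dpull f u c = u (f c).
Proof. by []. Qed.

Lemma dpullM C D (f : cmor C D) (u v : dual D) :
  dpull f (dmul u v) = dmul (dpull f u) (dpull f v).
Proof.
apply: dual_eq => c; rewrite -[LHS]/(pull f (lconv u v) c).
by rewrite pull_lconv.
Qed.

Lemma dpull1 C D (f : cmor C D) : dpull f (dunit D) = dunit C.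
Proof. by apply: dual_eq => c; rewrite /= c_cou. Qed.

Definition tmor C C' D D' (f : cmor C C') (g : cmor D D') :
  cmor (C ** D) (C' ** D').
Proof.
refine (@Cmor B (C ** D) (C' ** D') (fun p => (f p.1, g p.2)) _ _ _ _ _ _ _).
- move=> G h [h1 h2 h3 h4]; split=> [d|c|c b d|c b d] /=.
  + exact: (c_adm f (h1 (g d))).
  + exact: (c_adm g (h2 (f c))).
  + by rewrite (c_ra f c b (h1 _)) h3 (c_la g b d (h2 _)).
  + by rewrite (c_rb f c b (h1 _)) h4 (c_lb g b d (h2 _)).
- by move=> G h b [c d] [h1 _ _ _]; apply: (c_la f b c (h1 (g d))).
- by move=> G h b [c d] [h1 _ _ _]; apply: (c_lb f b c (h1 (g d))).
- by move=> G h [c d] b [_ h2 _ _]; apply: (c_ra g d b (h2 (f c))).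
- by move=> G h [c d] b [_ h2 _ _]; apply: (c_rb g d b (h2 (f c))).
- move=> G K [c d] KP; rewrite tens_copE.
  rewrite [RHS](tens_copE (fun z z' : C ** D =>
    K (f z.1, g z.2) (f z'.1, g z'.2))) /=.
  rewrite (c_cop _ _ (tens_bal2r (f c) KP)); apply: eq_bigr => y _.
  exact: (c_cop _ _ (tens_bal2l _ _ KP)).
- by move=> [c d];
  rewrite /= /tens_cou /= c_cou -(c_ra f c _ (cou_adm C')) c_cou.
Defined.

Definition tassoc C D E : cmor (C ** D ** E) (C ** (D ** E)).
Proof.
refine (@Cmor B (C ** D ** E) (C ** (D ** E))
  (fun p => (p.1.1, (p.1.2, p.2))) _ _ _ _ _ _ _) => //.
- move=> G h hP; split=> [e|[c d]|[c d] b e|[c d] b e] /=.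
  + split=> [d|c|c b d|c b d] /=.
    * exact: tens_adml hP _.
    * exact: tens_adml (tens_admr hP c) e.
    * exact: (tens_bal hP c b (d, e)).
    * exact: (tens_balbar hP c b (d, e)).
  + exact: tens_admr (tens_admr hP c) d.
  + exact: (tens_bal (tens_admr hP c)).
  + exact: (tens_balbar (tens_admr hP c)).
- move=> G K [[c d] e] KP; rewrite tens_copE /=.
  rewrite (tens_copE (fun z z' => \sum_(x <- cop c) K (x.1, z) (x.2, z'))).
  rewrite [RHS](tens_copE (fun z z' : C ** D ** E =>
    K (z.1.1, (z.1.2, z.2)) (z'.1.1, (z'.1.2, z'.2)))) /=.
  apply: eq_bigr => y _.
  by rewrite (tens_copE (fun z z' : C ** D =>
    K (z.1, (z.2, y.1)) (z'.1, (z'.2, y.2)))).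
Defined.

Definition tassocV C D E : cmor (C ** (D ** E)) (C ** D ** E).
Proof.
refine (@Cmor B (C ** (D ** E)) (C ** D ** E)
  (fun p => ((p.1, p.2.1), p.2.2)) _ _ _ _ _ _ _) => //.
- move=> G h hP; split=> [[d e]|c|c b [d e]|c b [d e]] /=.
  + exact: tens_adml (tens_adml hP e) d.
  + split=> [e|d|d b e|d b e] /=.
    * exact: tens_admr (tens_adml hP e) c.
    * exact: tens_admr hP (c, d).
    * exact: (tens_bal hP (c, d)).
    * exact: (tens_balbar hP (c, d)).
  + exact: (tens_bal (tens_adml hP e)).
  + exact: (tens_balbar (tens_adml hP e)).
- move=> G K [c [d e]] KP; rewrite tens_copE /=.
  rewrite [RHS](tens_copE (fun z z' : C ** (D ** E) =>
    K (z.1, z.2.1, z.2.2) (z'.1, z'.2.1, z'.2.2))) /=.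
  rewrite (tens_copE (fun z z' => \sum_(x <- cop c)
    K (x.1, z.1, z.2) (x.2, z'.1, z'.2))) /=.
  apply: eq_bigr => y _.
  by rewrite (tens_copE (fun z z' => K (z, y.1) (z', y.2))).
Defined.

(** * Cochains on a tensor product *)

Section TensorElements.
Variables C D : coalg B.

(** Balancing over B is left linearity of v. For \bar b the factor b lands on the wrong side of
    v(Y); replacing the right action under u by the barred one reverses products and repairs the
    order. *)
Lemma tdual_proof (u : dual C) (v : dual D) :
  tens_adm (fun p => u (ra p.1 (v p.2)) : B).
Proof.
split=> [d|c|c b d|c b d] /=.
- exact: adm_ra (h_adm u).
- apply: (@adm_comp B D R R (fun b : B => u (ra c b)) v) (h_adm v).
  exact: adm_raD (h_adm u).
- by rewrite h_la raM.
- by rewrite h_lb !(dualP u) rbM.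
Qed.

Definition thom (u : dual C) (v : dual D) : hom (C ** D) R.
Proof.
refine (@Hom _ (C ** D) R _ (tdual_proof u v) _ _) => b [c d] /=.
- by rewrite -la_ra h_la.
- by rewrite -lb_ra h_lb.
Defined.

Lemma good_thom u v : good (thom u v).
Proof. by move=> [c d] b; rewrite /= (dualP v). Qed.

Definition tdual (u : dual C) (v : dual D) : dual (C ** D) :=
  Dual (good_thom u v).

Definition tslice M (F : hom (C ** D) M) (d : D) : hom C M.
Proof.
refine (@Hom _ C M (fun c => F (c, d)) (tens_adml (h_adm F) d) _ _) => b c.
- exact: h_la F b (c, d).
- exact: h_lb F b (c, d).
Defined.

Lemma tens_sumE (G : zmodType) (K : C ** D -> C ** D -> G) c d :
  \sum_(z <- cop ((c, d) : C ** D)) K z.1 z.2 =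
  \sum_(y <- cop d) \sum_(x <- cop c) K (x.1, y.1) (x.2, y.2).
Proof. exact: tens_copE. Qed.

Lemma lconv_tens M (u : hom (C ** D) R) (F : hom (C ** D) M) c d :
  lconv u F (c, d) =
  \sum_(y <- cop d) \sum_(x <- cop c) mla (u (x.1, y.1)) (F (x.2, y.2)).
Proof. exact: (tens_sumE (fun z z' => mla (u z) (F z'))). Qed.

Lemma rconv_tens M (u : hom (C ** D) R) (F : hom (C ** D) M) c d :
  rconv F u (c, d) =
  \sum_(y <- cop d) \sum_(x <- cop c) mlb (u (x.2, y.2)) (F (x.1, y.1)).
Proof. exact: (tens_sumE (fun z z' => mlb (u z') (F z))). Qed.

Lemma lconv_tens_la M (u : hom (C ** D) R) (F : hom (C ** D) M) c b d :
  lconv u F (c, la b d) =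
  \sum_(y <- cop d) \sum_(x <- cop c) mla (u (x.1, la b y.1)) (F (x.2, y.2)).
Proof.
by rewrite lconv_tens (cop_la _ _ (tens_bal2r c (lconv_bal2 u F))).
Qed.

Lemma rconv_tens_la M (u : hom (C ** D) R) (F : hom (C ** D) M) c b d :
  rconv F u (c, la b d) =
  \sum_(y <- cop d) \sum_(x <- cop c) mlb (u (x.2, y.2)) (F (x.1, la b y.1)).
Proof.
by rewrite rconv_tens (cop_la _ _ (tens_bal2r c (rconv_bal2 F u))).
Qed.

(** The value of v sits on the first leg of c. Goodness of u makes it barred, Takeuchi takes it to
    the second leg, and balancing of F carries it over to d. This is the origin of arguments like
    \Sigma(Y_1,Z_1) Y_2 Z_2. *)
Lemma lconv_tdual M (u : dual C) (v : dual D) (F : hom (C ** D) M) c d :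
  lconv (tdual u v) F (c, d) =
  \sum_(y <- cop d) \sum_(x <- cop c) mla (u x.1) (F (x.2, la (v y.1) y.2)).
Proof.
rewrite lconv_tens; apply: eq_bigr => y _ /=.
transitivity (\sum_(x <- cop c) mla (u (rb x.1 (v y.1))) (tslice F y.2 x.2)).
  by apply: eq_bigr => x _; rewrite (dualP u).
rewrite (cop_tak _ _ (lconv_bal2 u (tslice F y.2))); apply: eq_bigr => x _ /=.
by rewrite (tens_bal (h_adm F)).
Qed.

(** Mirror image: the value of v travels in the opposite direction and arrives barred, as in the
    inner \Sigma^{-1} of the coboundary. *)
Lemma rconv_tdual M (u : dual C) (v : dual D) (F : hom (C ** D) M) c d :
  rconv F (tdual u v) (c, d) =
  \sum_(y <- cop d) \sum_(x <- cop c) mlb (u x.2) (F (x.1, lb (v y.2) y.1)).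
Proof.
rewrite rconv_tens; apply: eq_bigr => y _ /=.
transitivity (\sum_(x <- cop c) mlb (u (ra x.2 (v y.2))) (tslice F y.1 x.1)).
  by [].
rewrite -(cop_tak _ _ (rconv_bal2 (tslice F y.1) u)); apply: eq_bigr => x _ /=.
by rewrite (tens_balbar (h_adm F)).
Qed.

Lemma lconv_tdual1 M (u : dual C) (F : hom (C ** D) M) c d :
  lconv (tdual u (dunit D)) F (c, d) = lconv u (tslice F d) c.
Proof.
rewrite lconv_tdual exchange_big; apply: eq_bigr => x _ /=.
rewrite -(addmap_sum _ _ (mlaDr _)); congr mla.
exact: couL (tens_admr (h_adm F) x.2).
Qed.

Lemma rconv_tdual1 M (u : dual C) (F : hom (C ** D) M) c d :
  rconv F (tdual u (dunit D)) (c, d) = rconv (tslice F d) u c.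
Proof.
rewrite rconv_tdual exchange_big; apply: eq_bigr => x _ /=.
rewrite -(addmap_sum _ _ (mlbDr _)); congr mlb.
exact: couR (tens_admr (h_adm F) x.1).
Qed.

Lemma lconv_1tdual M (v : dual D) (F : hom (C ** D) M) c d :
  lconv (tdual (dunit C) v) F (c, d) =
  \sum_(y <- cop d) F (c, la (v y.1) y.2).
Proof.
rewrite lconv_tdual; apply: eq_bigr => y _.
by rewrite -[RHS]/(tslice F _ c) -[RHS]/(hfun _ c) -(lconv1 (tslice F _)).
Qed.

Lemma rconv_1tdual M (v : dual D) (F : hom (C ** D) M) c d :
  rconv F (tdual (dunit C) v) (c, d) =
  \sum_(y <- cop d) F (c, lb (v y.2) y.1).
Proof.
rewrite rconv_tdual; apply: eq_bigr => y _.
by rewrite -[RHS]/(tslice F _ c) -(rconv1 (tslice F _)).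
Qed.

(** The interchange law. It makes insertion of a cochain on some legs multiplicative, and cochains
    on disjoint legs commute. *)
Lemma tdualM (u u' : dual C) (v v' : dual D) :
  dmul (tdual u v) (tdual u' v') = tdual (dmul u u') (dmul v v').
Proof.
apply: dual_eq => -[c d].
rewrite -[LHS]/(lconv (tdual u v) (tdual u' v') (c, d)).
rewrite lconv_tdual -[RHS]/(lconv u u' (ra c (lconv v v' d))).
rewrite [X in ra c X]/= (addmap_sum _ _ (adm_raD c (h_adm (lconv u u')))).
apply: eq_bigr => y _; rewrite (lconv_ra _ _ _ (dualP u)).
by apply: eq_bigr => x _; rewrite /= h_la.
Qed.

Lemma tdual11 : tdual (dunit C) (dunit D) = dunit (C ** D).
Proof. exact: dual_eq. Qed.

End TensorElements.

(* The map fs is f conjugated by u: [conj_by] tests this on left linear maps,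
   [sconj_by] on all maps out of D. *)
Definition conj_by C D (fs f : cmor C D) (u u' : dual C) :=
  forall M (F : hom D M), pull fs F = lconv u (rconv (pull f F) u').

Definition sconj_by C D (fs f : cmor C D) (u u' : dual C) :=
  forall (G : zmodType) (K : D -> G) c, adm K -> K (fs c) =
    \sum_(x <- cop c) \sum_(y <- cop x.2) K (la (u x.1) (lb (u' y.2) (f y.1))).

Lemma sconj_conj C D (fs f : cmor C D) u u' : sconj_by fs f u u' -> conj_by fs f u u'.
Proof.
move=> H M F; apply: hom_eq => c; rewrite /= (H _ _ _ (h_adm F)).
apply: eq_bigr => x _; rewrite (addmap_sum _ _ (mlaDr _)).
by apply: eq_bigr => y _; rewrite h_la h_lb.
Qed.

Lemma conj_tensl C C' D (fs f : cmor C C') u u' : conj_by fs f u u' ->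
  conj_by (tmor fs (idmor D)) (tmor f (idmor D))
    (tdual u (dunit D)) (tdual u' (dunit D)).
Proof.
move=> H M F; apply: hom_eq => -[c d]; rewrite lconv_tdual1.
have -> : tslice (rconv (pull (tmor f (idmor D)) F) (tdual u' (dunit D))) d =
          rconv (pull f (tslice F d)) u'.
  by apply: hom_eq => c'; apply: rconv_tdual1.
by rewrite -H.
Qed.

(** For fixed c the map F(c, -) is additive but not left linear, so testing on left linear maps says
    nothing about it: the strong form of conjugacy is required here. On the left factor the slices
    F(-, d) are left linear and the weak form is enough. *)
Lemma conj_tensr C D D' (fs f : cmor D D') u u' : sconj_by fs f u u' ->
  conj_by (tmor (idmor C) fs) (tmor (idmor C) f)
    (tdual (dunit C) u) (tdual (dunit C) u').
Proof.
move=> H M F; set F' := pull (tmor (idmor C) f) F.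
apply: hom_eq => -[c d]; rewrite lconv_1tdual -[LHS]/(F (c, fs d)).
rewrite (H _ _ _ (tens_admr (h_adm F) c)); apply: eq_bigr => y _.
rewrite -[RHS]/(rconv F' (tdual (dunit C) u') (c, la (u y.1) y.2)) rconv_1tdual.
pose K (d d' : D) := F' (c, lb (u' d') d).
have FP := tens_admr (h_adm F') c.
have KP : bal2 K.
  split=> [d'|d1|b d1 d'].
  - exact: adm_lb FP.
  - apply: (@adm_comp B D R M (fun b : B => F' (c, lb b d1)) u') (h_adm u').
    exact: adm_lbD FP.
  - by rewrite /K h_la lbM.
rewrite (cop_la _ _ KP); apply: eq_bigr => y' _.
rewrite /K /= -la_lb; have Fc := tens_admr (h_adm F) c.
by rewrite (c_la f _ _ Fc) (c_lb f _ _ (adm_la _ Fc)).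
Qed.

Lemma conj_comp C D E (fs f : cmor D E) (g : cmor C D) u u' : conj_by fs f u u' ->
  conj_by (cmor_comp fs g) (cmor_comp f g) (dpull g u) (dpull g u').
Proof.
move=> H M F; have -> : pull (cmor_comp fs g) F = pull g (pull fs F) by apply: hom_eq.
rewrite H pull_lconv pull_rconv.
by congr (lconv _ (rconv _ _)); apply: hom_eq.
Qed.

Lemma conj_dpull C D (fs f : cmor C D) (u u' : dual C) (w : dual D) :
  conj_by fs f u u' -> dpull fs w = dmul u (dmul (dpull f w) u').
Proof.
move=> H; apply: dual_eq => c; rewrite -[LHS]/(pull fs w c) H.
by rewrite rconvR.
Qed.

End Morphisms.

(** * Twisting an associative product *)

Section Unit.
Variables (B : nzRingType) (L : coalg B) (one : L).

Record unit_gen : Prop := UnitGen {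
  one_cop : forall (G : zmodType) (K : L -> L -> G), bal2 K ->
    \sum_(x <- cop one) K x.1 x.2 = K one one;
  one_cou : cou one = 1;
  one_la : forall b, la b one = ra one b;
  one_lb : forall b, lb b one = rb one b
}.

Hypothesis oneP : unit_gen.

(** Normalisation of a cochain becomes triviality of its pullback along insertion of the unit;
    pullback is multiplicative, so a product can be tested factor by factor. *)
Definition insl (C : coalg B) : cmor C (L ** C).
Proof.
refine (@Cmor B C (L ** C) (fun c => (one, c)) _ _ _ _ _ _ _) => //.
- by move=> G f fP; apply: tens_admr fP one.
- by move=> G f b c fP; rewrite -(tens_bal fP) -(one_la oneP).
- by move=> G f b c fP; rewrite -(tens_balbar fP) -(one_lb oneP).
- move=> G K c KP; rewrite tens_copE; apply: eq_bigr => y _.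
  exact: (one_cop oneP (tens_bal2l y.1 y.2 KP)).
- by move=> c; rewrite /= /tens_cou /= -(one_la oneP) cou_la (one_cou oneP) mulr1.
Defined.

Definition insr (C : coalg B) : cmor C (C ** L).
Proof.
refine (@Cmor B C (C ** L) (fun c => (c, one)) _ _ _ _ _ _ _) => //.
- by move=> G f fP; apply: tens_adml fP one.
- by move=> G f c b fP; rewrite (tens_bal fP) (one_la oneP).
- by move=> G f c b fP; rewrite (tens_balbar fP) (one_lb oneP).
- move=> G K c KP; rewrite tens_copE.
  exact: (one_cop oneP (tens_bal2r c KP)).
- by move=> c; rewrite /= /tens_cou /= (one_cou oneP) ra1.
Defined.

End Unit.

Section Twist.
Variables (B : nzRingType) (L : coalg B) (m ms : cmor (L ** L) L).
Variables s s' : dual (L ** L).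
Hypothesis mA : forall x y z, m (m (x, y), z) = m (x, m (y, z)).
Hypothesis ss' : dmul s s' = dunit (L ** L).
Hypothesis s's : dmul s' s = dunit (L ** L).
Hypothesis msE : sconj_by ms m s s'.

Local Notation V2 := (L ** L).
Local Notation V3 := (L ** L ** L).
Local Notation V4 := (L ** L ** L ** L).
Local Infix "*d" := (@dmul _ _) (at level 40, left associativity).

(* Leg notation: [e12_3 w] is w(XY, Z), [e12 w] is w(X, Y eps(Z)). *)
Definition e12 (w : dual V2) : dual V3 := tdual w (dunit L).
Definition e12_3 (w : dual V2) : dual V3 := dpull (tmor m (idmor L)) w.
Definition e23 (w : dual V2) : dual V3 :=
  dpull (tassoc L L L) (tdual (dunit L) w).
Definition e1_23 (w : dual V2) : dual V3 :=
  dpull (cmor_comp (tmor (idmor L) m) (tassoc L L L)) w.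

Definition drinfeld : dual V3 :=
  e23 s *d e1_23 s *d (e12_3 s' *d e12 s').

Definition drinfeld_inv : dual V3 :=
  e12 s *d e12_3 s *d (e1_23 s' *d e23 s').

Lemma e12M w w' : e12 (w *d w') = e12 w *d e12 w'.
Proof. by rewrite /e12 tdualM dmul1. Qed.

Lemma e12_3M w w' : e12_3 (w *d w') = e12_3 w *d e12_3 w'.
Proof. exact: dpullM. Qed.

Lemma e23M w w' : e23 (w *d w') = e23 w *d e23 w'.
Proof. by rewrite /e23 -dpullM tdualM dmul1. Qed.

Lemma e1_23M w w' : e1_23 (w *d w') = e1_23 w *d e1_23 w'.
Proof. exact: dpullM. Qed.

Lemma e12_1 : e12 (dunit V2) = dunit V3.
Proof. exact: tdual11. Qed.

Lemma e12_3_1 : e12_3 (dunit V2) = dunit V3.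
Proof. exact: dpull1. Qed.

Lemma e23_1 : e23 (dunit V2) = dunit V3.
Proof. by rewrite /e23 tdual11 dpull1. Qed.

Lemma e1_23_1 : e1_23 (dunit V2) = dunit V3.
Proof. exact: dpull1. Qed.

(** Cancellation stated with an arbitrary tail z, so that it rewrites anywhere in a product nested
    to the right. *)
Let eK (e : dual V2 -> dual V3) : {morph e : w w' / w *d w'} ->
    e (dunit V2) = dunit V3 ->
  (forall z, e s *d (e s' *d z) = z) /\ (forall z, e s' *d (e s *d z) = z).
Proof. by move=> eM e1; split=> z; rewrite dmulA -eM ?ss' ?s's e1 dmul1. Qed.

Let e12K := eK e12M e12_1.
Let e12_3K := eK e12_3M e12_3_1.
Let e23K := eK e23M e23_1.
Let e1_23K := eK e1_23M e1_23_1.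

Let dsimp := (e12K.1, e12K.2, e12_3K.1, e12_3K.2, e23K.1, e23K.2,
  e1_23K.1, e1_23K.2).

Lemma drinfeldV : drinfeld *d drinfeld_inv = dunit V3.
Proof.
(* The unit appended on the right gives the last pair of factors the tail that the cancellation
   rules expect. *)
rewrite -[LHS]dmulr1 /drinfeld /drinfeld_inv -!dmulA.
by rewrite !dsimp.
Qed.

Lemma drinfeldVl : drinfeld_inv *d drinfeld = dunit V3.
Proof.
rewrite -[LHS]dmulr1 /drinfeld /drinfeld_inv -!dmulA.
by rewrite !dsimp.
Qed.

Lemma drinfeld_assoc M (F : hom L M) :
  lconv drinfeld (pull (cmor_comp ms (tmor ms (idmor L))) F) =
  rconv (pull (cmor_comp ms (cmor_comp (tmor (idmor L) ms) (tassoc L L L))) F) drinfeld.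
Proof.
have msC := sconj_conj msE.
pose G := pull (cmor_comp m (tmor m (idmor L))) F.
have -> : pull (cmor_comp ms (tmor ms (idmor L))) F =
    lconv (e12 s *d e12_3 s) (rconv G (e12_3 s' *d e12 s')).
  transitivity (pull (tmor ms (idmor L)) (pull ms F)); first exact: hom_eq.
  rewrite (conj_tensl msC) msC pull_lconv pull_rconv.
  rewrite -lrconv rconv_dmul lconv_dmul.
  by have <- : pull (tmor m (idmor L)) (pull m F) = G by apply: hom_eq.
have -> : pull (cmor_comp ms (cmor_comp (tmor (idmor L) ms) (tassoc L L L))) F =
    lconv (e23 s *d e1_23 s) (rconv G (e1_23 s' *d e23 s')).
  transitivity (pull (cmor_comp (tmor (idmor L) ms) (tassoc L L L)) (pull ms F)).
    exact: hom_eq.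
  rewrite (conj_comp (tassoc L L L) (conj_tensr msE)) msC.
  rewrite pull_lconv pull_rconv -lrconv rconv_dmul lconv_dmul.
  have <- : pull (cmor_comp (tmor (idmor L) m) (tassoc L L L)) (pull m F) = G.
    by apply: hom_eq => -[[x y] z] /=; rewrite mA.
  by [].
(* Both bracketings are conjugates of the same [G]. On one side [drinfeld] replaces the left
   conjugating factor, on the other the right one; the two results agree. *)
rewrite -lrconv -lconv_dmul -rconv_dmul.
have -> : drinfeld *d (e12 s *d e12_3 s) = e23 s *d e1_23 s.
  by rewrite /drinfeld -[LHS]dmulr1 -!dmulA !dsimp dmulr1.
have -> // : e1_23 s' *d e23 s' *d drinfeld = e12_3 s' *d e12 s'.
by rewrite /drinfeld -[LHS]dmulr1 -!dmulA !dsimp dmulr1.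
Qed.

(* On four legs: [tail4], [head4] and [e34] insert a cochain on the last
   three, the first three and the last two legs. *)
Definition a4 : cmor V4 (L ** V3) :=
  cmor_comp (tassoc L V2 L) (tmor (tassoc L L L) (idmor L)).

Definition mul1 (f : cmor V2 L) : cmor V4 V3 := tmor (tmor f (idmor L)) (idmor L).
Definition mul2 (f : cmor V2 L) : cmor V4 V3 :=
  tmor (cmor_comp (tmor (idmor L) f) (tassoc L L L)) (idmor L).
Definition mul3 (f : cmor V2 L) : cmor V4 V3 :=
  cmor_comp (tmor (idmor V2) f) (tassoc V2 L L).

Definition tail4 (w : dual V3) : dual V4 := dpull a4 (tdual (dunit L) w).
Definition head4 (w : dual V3) : dual V4 := tdual w (dunit L).
Definition e34 (w : dual V2) : dual V4 :=
  dpull (tassoc V2 L L) (tdual (dunit V2) w).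

Lemma tail4M v w : tail4 (v *d w) = tail4 v *d tail4 w.
Proof. by rewrite /tail4 -dpullM tdualM dmul1. Qed.

Lemma head4M v w : head4 (v *d w) = head4 v *d head4 w.
Proof. by rewrite /head4 tdualM dmul1. Qed.

(** The value of [tail4 u] reappears as a left action on the second leg, which is the nested
    argument on the right of the cocycle identity. There v is the pullback of u along multiplication
    of the two middle legs. *)
Lemma cocycle_rhsE (u : dual V3) (v : dual V4) x y z t :
  (tail4 u *d (v *d head4 u)) (((x, y), z), t) =
  \sum_(q <- cop (((y, z), t) : V3)) \sum_(p <- cop q.2.1) \sum_(c <- cop x)
    v (((c.1, la (u q.1) p.1.1), p.1.2), q.2.2) * u ((c.2, p.2.1), p.2.2).
Proof.
(* The rebracketing inverse to [a4]: with the first leg split off, [tail4 u] has the form 1 \otimes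
   u, to which [lconv_1tdual] applies. *)
pose b4 : cmor (L ** V3) V4 :=
  cmor_comp (tmor (tassocV L L L) (idmor L)) (tassocV L V2 L).
have b4K : dpull b4 (tail4 u) = tdual (dunit L) u.
  by apply: dual_eq => -[x' [[y' z'] t']].
have vu p : (v *d head4 u) p = rconv v (head4 u) p by rewrite rconvR.
(* The product is made opaque so that later conversions compare arguments only and do not unfold
   convolution sums. *)
move: (v *d head4 u) vu => w vu.
transitivity (dpull b4 (tail4 u *d w) (x, ((y, z), t))).
  by move: (tail4 u *d w) => n.
rewrite dpullM b4K.
rewrite -[LHS]/(lconv (tdual (dunit L) u) (dpull b4 w) (x, ((y, z), t))).
rewrite lconv_1tdual; apply: eq_bigr => -[q1 [[y' z'] t']] _.
rewrite -[LHS]/(w (((x, la (u q1) y'), z'), t')) vu rconv_tdual1.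
transitivity (rconv (pull (tassocV L L L) (tslice v t')) (pull (tassocV L L L) u)
    (x, la (u q1) ((y', z') : V2))).
  by rewrite -pull_rconv.
rewrite rconv_tens_la; apply: eq_bigr => p _; apply: eq_bigr => c _.
by rewrite !pullE [LHS]/= [RHS]/=.
Qed.

Lemma cou_m x y : cou (m (x, y)) = cou (ra x (cou y)).
Proof. exact: c_cou. Qed.

(** * Face identities between three and four legs *)

Section Faces.
Variable w : dual V2.
Lemma face3_23 : dpull (mul3 m) (e23 w) = tail4 (e1_23 w).
Proof. exact: dual_eq. Qed.
Lemma face3_12 : dpull (mul3 m) (e12 w) = head4 (e12 w).
Proof. by apply: dual_eq => -[[[x y] z] t] /=; rewrite cou_m. Qed.
Lemma face1_23 : dpull (mul1 m) (e23 w) = e34 w.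
Proof.
by apply: dual_eq => -[[[x y] z] t] /=;
  rewrite /tens_cou /= -(c_ra m _ _ (cou_adm L)) cou_m.
Qed.
Lemma face1_1_23 : dpull (mul1 m) (e1_23 w) = dpull (mul3 m) (e12_3 w).
Proof. exact: dual_eq. Qed.
Lemma face1_12 : dpull (mul1 m) (e12 w) = head4 (e12_3 w).
Proof. exact: dual_eq. Qed.
Lemma face2_23 : dpull (mul2 m) (e23 w) = tail4 (e12_3 w).
Proof. exact: dual_eq. Qed.
(** Here, and in [face2_12_3], associativity of m enters the cocycle identity: multiplying three
    legs in a row does not depend on the bracketing. *)
Lemma face2_1_23 : dpull (mul2 m) (e1_23 w) = dpull (mul3 m) (e1_23 w).
Proof. by apply: dual_eq => -[[[x y] z] t] /=; rewrite mA. Qed.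
Lemma face2_12_3 : dpull (mul2 m) (e12_3 w) = dpull (mul1 m) (e12_3 w).
Proof. by apply: dual_eq => -[[[x y] z] t] /=; rewrite mA. Qed.
Lemma face2_12 : dpull (mul2 m) (e12 w) = head4 (e1_23 w).
Proof.
apply: dual_eq => -[[[x y] z] t] /=.
exact: esym (c_ra m (y, z) (cou t) (tens_admr (h_adm w) x)).
Qed.
Lemma tail4_23 : tail4 (e23 w) = e34 w.
Proof. exact: dual_eq. Qed.
Lemma tail4_12 : tail4 (e12 w) = head4 (e23 w).
Proof. exact: dual_eq. Qed.
End Faces.

(** Bracketed as V2 \otimes V2, the two cochains live on different factors, so the interchange law
    makes them commute. *)
Lemma e34_e12 w w' : e34 w *d head4 (e12 w') = head4 (e12 w') *d e34 w.
Proof.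
have -> : head4 (e12 w') = dpull (tassoc V2 L L) (tdual w' (dunit V2)).
  exact: dual_eq.
by rewrite /e34 -!dpullM !tdualM !dmul1 !dmulr1.
Qed.

Lemma drinfeld_cocycle :
  dpull (mul3 ms) drinfeld *d dpull (mul1 ms) drinfeld =
  tail4 drinfeld *d (dpull (mul2 ms) drinfeld *d head4 drinfeld).
Proof.
have msC := sconj_conj msE.
(* Each twisted multiplication becomes conjugation by the twist on the legs it multiplies. After
   that only pullbacks along m remain, which the face identities govern. *)
have C3 := conj_dpull drinfeld (conj_comp (tassoc V2 L L) (conj_tensr (C := V2) msE)).
have C1 := conj_dpull drinfeld (conj_tensl (D := L) (conj_tensl (D := L) msC)).
have C2 := conj_dpull drinfeld
  (conj_tensl (D := L) (conj_comp (tassoc L L L) (conj_tensr (C := L) msE))).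
have -> : dpull (mul3 ms) drinfeld =
    e34 s *d (dpull (mul3 m) drinfeld *d e34 s') := C3.
have -> : dpull (mul1 ms) drinfeld =
    head4 (e12 s) *d (dpull (mul1 m) drinfeld *d head4 (e12 s')) := C1.
have -> : dpull (mul2 ms) drinfeld =
    head4 (e23 s) *d (dpull (mul2 m) drinfeld *d head4 (e23 s')) := C2.
have headK e z : {morph e : w w' / w *d w'} -> e (dunit V2) = dunit V3 ->
    head4 (e s') *d (head4 (e s) *d z) = z.
  by move=> eM e1; rewrite dmulA -head4M -eM s's e1 /head4 tdual11 dmul1.
have tailK z : tail4 (e12_3 s') *d (tail4 (e12_3 s) *d z) = z.
  by rewrite dmulA -tail4M -e12_3M s's e12_3_1 /tail4 tdual11 dpull1 dmul1.
have mul3K z : dpull (mul3 m) (e12_3 s') *d (dpull (mul3 m) (e12_3 s) *d z) = z.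
  by rewrite dmulA -dpullM -e12_3M s's e12_3_1 dpull1 dmul1.
have e34K z : e34 s' *d (e34 s *d z) = z.
  by rewrite dmulA /e34 -dpullM tdualM s's dmul1 tdual11 dpull1 dmul1.
rewrite /drinfeld !(dpullM, tail4M, head4M).
rewrite face3_23 face3_12 face1_23 face1_1_23 face1_12 face2_23 face2_1_23.
rewrite face2_12_3 face2_12 tail4_23 tail4_12 -!dmulA.
(* On the left the inverse pair on legs 3 and 4 is separated by [head4 (e12 s)]; once the commuting
   factor is moved away, both sides telescope. *)
rewrite (dmulA (head4 (e12 s)) (e34 s)) -e34_e12 -dmulA e34K.
rewrite (headK _ _ e12M e12_1) mul3K (headK _ _ e23M e23_1) tailK.
by rewrite (headK _ _ e23M e23_1) (headK _ _ e1_23M e1_23_1).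
Qed.

(** * Normalisation of the coboundary *)

Section Units.
Variable one : L.
Hypothesis oneP : unit_gen one.
Hypothesis m1x : forall x, m (one, x) = x.
Hypothesis mx1 : forall x, m (x, one) = x.
Hypothesis s1x : forall x, s (one, x) = cou x.
Hypothesis sx1 : forall x, s (x, one) = cou x.

(** Pullback preserves inverses, and the inverse of the unit is the unit: s' inherits normalisation
    from s. *)
Let inv1 (f : cmor L V2) : dpull f s = dunit L -> dpull f s' = dunit L.
Proof.
by move=> fs; rewrite -[LHS]dmul1 -fs -dpullM ss' dpull1.
Qed.

Lemma s'1x x : s' (one, x) = cou x.
Proof.
rewrite -[LHS]/(dpull (insl oneP L) s' x) inv1 //.
by apply: dual_eq => y; apply: s1x.
Qed.

Lemma s'x1 x : s' (x, one) = cou x.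
Proof.
rewrite -[LHS]/(dpull (insr oneP L) s' x) inv1 //.
by apply: dual_eq => y; apply: sx1.
Qed.

Let cou1 b : cou (ra one b) = b.
Proof. by rewrite -(one_la oneP) cou_la (one_cou oneP) mulr1. Qed.

(** When one argument is 1, two of the four factors become trivial and the other two restrict to s
    and s', which cancel. Only the surviving pair varies with the position of 1. *)
Lemma drinfeld_1xy : dpull (tmor (insl oneP L) (idmor L)) drinfeld = dunit V2.
Proof.
rewrite /drinfeld !dpullM.
set j := tmor _ _.
have -> : dpull j (e23 s) = s by apply: dual_eq => -[x y]; apply: cou1.
have -> : dpull j (e1_23 s) = dunit V2.
  by apply: dual_eq => -[x y] /=; rewrite s1x cou_m.
have -> : dpull j (e12_3 s') = s' by apply: dual_eq => -[x y] /=; rewrite m1x.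
have -> : dpull j (e12 s') = dunit V2 by apply: dual_eq => -[x y]; apply: s'1x.
by rewrite !dmulr1.
Qed.

Lemma drinfeld_x1y : dpull (tmor (insr oneP L) (idmor L)) drinfeld = dunit V2.
Proof.
rewrite /drinfeld !dpullM.
set j := tmor _ _.
have -> : dpull j (e23 s) = dunit V2.
  by apply: dual_eq => -[x y] /=; rewrite s1x.
have -> : dpull j (e1_23 s) = s by apply: dual_eq => -[x y] /=; rewrite m1x.
have -> : dpull j (e12_3 s') = s' by apply: dual_eq => -[x y] /=; rewrite mx1.
have -> : dpull j (e12 s') = dunit V2.
  (* As 1 b = b 1, balancing carries eps(y) over to x, which leaves 1 alone in the second
     argument. *)
  apply: dual_eq => -[x y]; rewrite -[LHS]/(s' (x, ra one (cou y))).
  rewrite -(one_la oneP) -(tens_bal (h_adm s')).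
  exact: s'x1.
by rewrite dmul1 dmulr1.
Qed.

Lemma drinfeld_xy1 : dpull (insr oneP V2) drinfeld = dunit V2.
Proof.
rewrite /drinfeld !dpullM.
set j := insr _ _.
have -> : dpull j (e23 s) = dunit V2.
  by apply: dual_eq => -[x y] /=; rewrite sx1.
have -> : dpull j (e1_23 s) = s by apply: dual_eq => -[x y] /=; rewrite mx1.
have -> : dpull j (e12_3 s') = dunit V2.
  by apply: dual_eq => -[x y] /=; rewrite s'x1 cou_m.
have -> : dpull j (e12 s') = s'.
  apply: dual_eq => -[x y]; rewrite -[LHS]/(s' (x, ra y (cou one))).
  by rewrite (one_cou oneP) ra1.
by rewrite !dmul1.
Qed.

End Units.

End Twist.

(** * The coalgebroid of a left bialgebroid *)

Lemma linear_addmap (R : nzRingType) (U V : lmodType R) (f : U -> V) :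
  linear f -> addmap f.
Proof. by move=> fL x y; rewrite -[x]scale1r fL !scale1r. Qed.

(** Universal property of a presented group, in the form needed to compare two representatives: the
    relators span the kernel, and h vanishes on their span by induction. *)
Lemma class_of_kernel (V G : zmodType) (rel : V -> Prop) (h : V -> G) x y :
  {morph h : u v / u - v} -> (forall u, rel u -> h u = 0) ->
  class_of rel x = class_of rel y -> h x = h y.
Proof.
move=> hB h0 /eqP; rewrite -Quotient.idealrBE => /asboolP xy.
apply/eqP; rewrite -subr_eq0 -hB; apply/eqP.
elim: xy => {x y} [u /h0 //||u v _ hu _ hv].
- by have := hB 0 0; rewrite !subrr.
- by rewrite hB hu hv subr0.
Qed.

Section FreeLift.
Variables (K : choiceType) (G : zmodType) (f : K -> G).

(** [fglift] takes values in a module over the coefficient ring, so G is viewed as a Z-module. *)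
Definition freeg_lift (D : {freeg K / int}) : G :=
  fglift (f : K -> zmodule G) D.

Lemma freeg_liftB : {morph freeg_lift : u v / u - v}.
Proof. exact: (lift_is_additive (f : K -> zmodule G)). Qed.

Lemma freeg_liftU x : freeg_lift << x >> = f x.
Proof. by rewrite /freeg_lift liftU scale1r. Qed.

Lemma freeg_liftD : addmap freeg_lift.
Proof. by move=> u v; apply/eqP; rewrite -subr_eq -freeg_liftB addrK. Qed.

End FreeLift.

Section Bimodule.
Variables (k : fieldType) (B : algType k).

Definition bimod_bispace (M : be_bimod B) : bispace B.
Proof.
refine (@Bispace B M (@lact k B M) (@lactbar k B M) (@ract k B M)
  (@ractbar k B M) (fun G f => addmap f)
  _ _ _ _ _ _ _ _ _ _ _ _ _ _ _ _ _ _ _ _).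
- move=> G I r f fD x y; rewrite -big_split /=.
  by apply: eq_bigr => i _; rewrite fD.
- by move=> G H h f hD fD x y; rewrite fD hD.
- by move=> G f b fD x y; rewrite (linear_addmap (lact_linearr b)) fD.
- by move=> G f b fD x y; rewrite (linear_addmap (lactbar_linearr b)) fD.
- by move=> G f b fD x y; rewrite (linear_addmap (ract_linearl b)) fD.
- by move=> G f b fD x y; rewrite (linear_addmap (ractbar_linearl b)) fD.
- by move=> G f c fD x y; rewrite (linear_addmap (lact_linearl c)) fD.
- by move=> G f c fD x y; rewrite (linear_addmap (lactbar_linearl c)) fD.
- by move=> G f c fD x y; rewrite (linear_addmap (ract_linearr c)) fD.
- by move=> G f c fD x y; rewrite (linear_addmap (ractbar_linearr c)) fD.
- exact: lactM.
- exact: lactbarM.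
- exact: ract1.
- exact: ractM.
- exact: ractbarM.
- exact: lact_lactbar.
- exact: lact_ract.
- exact: lact_ractbar.
- exact: lactbar_ract.
- exact: lactbar_ractbar.
Defined.

Variable M : be_bimod B.
Local Notation S := (bimod_bispace M).

(** Scalars act through B, so the relators for k-bilinearity of the diamond product are instances of
    balancing over B; this is why [adm] asks for additivity only. *)
Lemma lact_scale (a : k) (x : M) : lact (a%:A) x = a *: x.
Proof.
have lD := linear_addmap (lact_linearl x).
have l0 : lact 0 x = 0 := addmap0 lD.
by rewrite -[a%:A]addr0 (lact_linearl x) l0 addr0 lact1.
Qed.

Lemma lactbar_scale (a : k) (x : M) : lactbar (a%:A) x = a *: x.
Proof.
have lD := linear_addmap (lactbar_linearl x).
have l0 : lactbar 0 x = 0 := addmap0 lD.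
by rewrite -[a%:A]addr0 (lactbar_linearl x) l0 addr0 lactbar1.
Qed.

Lemma ract_scale (a : k) (x : M) : ract x (a%:A) = a *: x.
Proof.
have lD := linear_addmap (ract_linearr x).
have l0 : ract x 0 = 0 := addmap0 lD.
by rewrite -[a%:A]addr0 (ract_linearr x) l0 addr0 ract1.
Qed.

(** The justification of Sweedler calculus with lists: a balanced map kills every relator, so its
    sum depends only on the class in the diamond product. *)
Lemma diamond_sum_eq (G : zmodType) (K : S -> S -> G) (r r' : seq (M * M)) :
  bal2 K ->
  \sum_(x <- r) pure2 x.1 x.2 = \sum_(x <- r') pure2 x.1 x.2 ->
  \sum_(x <- r) K x.1 x.2 = \sum_(x <- r') K x.1 x.2.
Proof.
move=> KP; pose h := freeg_lift (fun p : M * M => K p.1 p.2).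
have hE (s : seq (M * M)) :
    \sum_(x <- s) K x.1 x.2 = h (\sum_(x <- s) << (x.1, x.2) >>).
  rewrite (addmap_sum _ _ (@freeg_liftD _ _ _ : addmap h)).
  by apply: eq_bigr => x _; rewrite /h freeg_liftU.
have pE (s : seq (M * M)) : \sum_(x <- s) pure2 x.1 x.2 =
    class_of (@diamond_rel k B M M) (\sum_(x <- s) << (x.1, x.2) >>).
  by rewrite raddf_sum.
rewrite !pE !hE; apply: class_of_kernel; first exact: freeg_liftB.
have [Kl Kr Kb] := KP.
move=> _ [m m' n|m n n'|a m n|b m n]; rewrite /h freeg_liftB ?freeg_liftD !freeg_liftU /=.
- by rewrite (Kl n) subrr.
- by rewrite (Kr m) subrr.
- by rewrite -lactbar_scale -lact_scale (Kb (a%:A)) subrr.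
- by rewrite (Kb b) subrr.
Qed.

Lemma diamond3_sum_eq (G : zmodType) (K : S -> S -> S -> G)
    (r r' : seq (M * M * M)) :
  bal3 K ->
  \sum_(x <- r) pure3 x.1.1 x.1.2 x.2 = \sum_(x <- r') pure3 x.1.1 x.1.2 x.2 ->
  \sum_(x <- r) K x.1.1 x.1.2 x.2 = \sum_(x <- r') K x.1.1 x.1.2 x.2.
Proof.
move=> KP; pose h := freeg_lift (fun p : M * M * M => K p.1.1 p.1.2 p.2).
have hE (s : seq (M * M * M)) : \sum_(x <- s) K x.1.1 x.1.2 x.2 =
    h (\sum_(x <- s) << (x.1.1, x.1.2, x.2) >>).
  rewrite (addmap_sum _ _ (@freeg_liftD _ _ _ : addmap h)).
  by apply: eq_bigr => x _; rewrite /h freeg_liftU.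
have pE (s : seq (M * M * M)) : \sum_(x <- s) pure3 x.1.1 x.1.2 x.2 =
    class_of (@diamond3_rel k B M M M) (\sum_(x <- s) << (x.1.1, x.1.2, x.2) >>).
  by rewrite raddf_sum.
rewrite !pE !hE; apply: class_of_kernel; first exact: freeg_liftB.
have [K1 K2 K3 K12 K23] := KP.
move=> _ [m m' p n|m p p' n|m p n n'|a m p n|a m p n|b m p n|b m p n];
  rewrite /h freeg_liftB ?freeg_liftD !freeg_liftU /=.
- by rewrite (K1 p n) subrr.
- by rewrite (K2 m n) subrr.
- by rewrite (K3 m p) subrr.
- by rewrite -lactbar_scale -lact_scale (K12 (a%:A)) subrr.
- by rewrite -lactbar_scale -lact_scale (K23 (a%:A)) subrr.
- by rewrite (K12 b) subrr.
- by rewrite (K23 b) subrr.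
Qed.

Lemma rep2P (t : diamond M M) : \sum_(x <- rep2 t) pure2 x.1 x.2 = t.
Proof. by rewrite /rep2; case: (cid (diamond_repr t)) => r /= <-. Qed.

Lemma pure2_bal : bal2 (fun m n : S => pure2 m n : diamond M M).
Proof.
split=> [n m m'|m n n'|b m n]; rewrite /pure2 -?raddfD.
- exact/class_of_eq/diamond_addl.
- exact/class_of_eq/diamond_addr.
- exact/class_of_eq/diamond_bal.
Qed.

(* For balanced [K], the additive map out of the diamond product it induces. *)
Definition dlift (G : zmodType) (K : M -> M -> G) (t : diamond M M) : G :=
  \sum_(x <- rep2 t) K x.1 x.2.

Section Lift.
Variables (G : zmodType) (K : S -> S -> G).
Hypothesis KP : bal2 K.

Lemma dlift_sum (r : seq (M * M)) :
  dlift K (\sum_(x <- r) pure2 x.1 x.2) = \sum_(x <- r) K x.1 x.2.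
Proof. by apply: diamond_sum_eq => //; rewrite rep2P. Qed.

Lemma dlift_pure m n : dlift K (pure2 m n) = K m n.
Proof.
by have := dlift_sum [:: (m, n)]; rewrite !big_cons !big_nil !addr0.
Qed.

Lemma dliftD : addmap (dlift K).
Proof.
move=> t u; rewrite -(rep2P t) -(rep2P u) -big_cat /= !dlift_sum.
by rewrite big_cat.
Qed.

End Lift.

Lemma dlift_eq (G : zmodType) (f g : diamond M M -> G) :
  addmap f -> addmap g -> (forall m n, f (pure2 m n) = g (pure2 m n)) -> f =1 g.
Proof.
move=> fD gD fg t; rewrite -(rep2P t) (addmap_sum _ _ fD) (addmap_sum _ _ gD).
by apply: eq_bigr.
Qed.

Lemma bal2_la (G : zmodType) (K : S -> S -> G) b :
  bal2 K -> bal2 (fun m n : S => K (la b m) n).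
Proof.
case=> Kl Kr Kb; split=> [n|m|a m n]; last by rewrite -[RHS]Kb /= lact_lactbar.
- exact: (adm_la (b0 := S) (f := K^~ n) b (Kl n)).
- exact: Kr.
Qed.

Lemma bal2_lb (G : zmodType) (K : S -> S -> G) b :
  bal2 K -> bal2 (fun m n : S => K m (lb b n)).
Proof.
case=> Kl Kr Kb; split=> [n|m|a m n]; last by rewrite [LHS]Kb /= lact_lactbar.
- exact: Kl.
- exact: (adm_lb (b0 := S) (f := K m) b (Kr m)).
Qed.

Lemma diamond_lactD b : addmap (@diamond_lact k B M M b).
Proof. exact: (dliftD (bal2_la b pure2_bal)). Qed.

Lemma diamond_lactbarD b : addmap (@diamond_lactbar k B M M b).
Proof. exact: (dliftD (bal2_lb b pure2_bal)). Qed.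

Lemma diamond_lact_pure b (m n : M) :
  diamond_lact b (pure2 m n) = pure2 (lact b m) n.
Proof. exact: (dlift_pure (bal2_la b pure2_bal) m n). Qed.

Lemma diamond_lactbar_pure b (m n : M) :
  diamond_lactbar b (pure2 m n) = pure2 m (lactbar b n).
Proof. exact: (dlift_pure (bal2_lb b pure2_bal) m n). Qed.

(** With this structure [Delta] is a map of left B^e-modules and can be composed with elements of
    the convolution bimodule. *)
Definition diamond_bmod : bmod B.
Proof.
refine (@Bmod B (diamond M M) (@diamond_lact k B M M) (@diamond_lactbar k B M M)
  _ diamond_lactD _ diamond_lactbarD _ _ _) => [t a b|t a b|a b|a b|a b].
- rewrite /diamond_lact -big_split; apply: eq_bigr => x _.
  by rewrite (linear_addmap (lact_linearl _)) (bal2l pure2_bal x.2).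
- rewrite /diamond_lactbar -big_split; apply: eq_bigr => x _.
  by rewrite (linear_addmap (lactbar_linearl _)) (bal2r pure2_bal x.1).
- apply: dlift_eq => [||m n]; first exact: diamond_lactD.
    by move=> t u; rewrite !diamond_lactD.
  by rewrite !diamond_lact_pure lactM.
- apply: dlift_eq => [||m n]; first exact: diamond_lactbarD.
    by move=> t u; rewrite !diamond_lactbarD.
  by rewrite !diamond_lactbar_pure lactbarM.
- apply: dlift_eq => [t u|t u|m n]; first by rewrite diamond_lactbarD diamond_lactD.
    by rewrite diamond_lactD diamond_lactbarD.
  by rewrite diamond_lactbar_pure !diamond_lact_pure diamond_lactbar_pure.
Defined.

Definition bimod_bmod : bmod B.
Proof.
refine (@Bmod B M (@lact k B M) (@lactbar k B M) _ _ _ _ _ _ _).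
- by move=> m; apply: linear_addmap; apply: lact_linearl.
- by move=> b; apply: linear_addmap; apply: lact_linearr.
- by move=> m; apply: linear_addmap; apply: lactbar_linearl.
- by move=> b; apply: linear_addmap; apply: lactbar_linearr.
- exact: lactM.
- exact: lactbarM.
- exact: lact_lactbar.
Defined.

End Bimodule.

Section Bialgebroid.
Variables (k : fieldType) (B : algType k) (L : coalgebroid B) (A : alg_data L).
Hypotheses (algA : is_algebra_over A) (cmpA : is_compatible A).

Local Notation S := (bimod_bispace L).
Local Notation "X *' Y" := (lmul A X Y) (at level 40, left associativity).

Section Coproduct.
Variables (G : zmodType) (K : S -> S -> G).
Hypothesis KP : bal2 K.

Lemma dlift_lact b t : dlift K (diamond_lact b t) = dlift (fun m : S => K (la b m)) t.
Proof.
rewrite /diamond_lact (addmap_sum _ _ (dliftD KP)).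
by apply: eq_bigr => x _; rewrite (dlift_pure KP).
Qed.

Lemma dlift_lactbar b t :
  dlift K (diamond_lactbar b t) = dlift (fun m n : S => K m (lb b n)) t.
Proof.
rewrite /diamond_lactbar (addmap_sum _ _ (dliftD KP)).
by apply: eq_bigr => x _; rewrite (dlift_pure KP).
Qed.

Lemma dlift_takeuchi b (X : L) :
  dlift (fun m : S => K (rb m b)) (Delta X) = dlift (fun m n : S => K m (ra n b)) (Delta X).
Proof.
have := congr1 (dlift K) (Delta_takeuchi X b).
rewrite !(addmap_sum _ _ (dliftD KP)).
under eq_bigr do rewrite (dlift_pure KP).
by under [in X in _ = X -> _]eq_bigr do rewrite (dlift_pure KP).
Qed.

Lemma bal2_mulr y y' : bal2 (fun x x' : S => K (x *' y) (x' *' y')).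
Proof.
have [Kl Kr Kb] := KP; split=> [x'|x|b x x'].
- move=> x z /=; rewrite (linear_addmap (mul_linearl algA _)); exact: Kl.
- move=> z x' /=; rewrite (linear_addmap (mul_linearl algA _)); exact: Kr.
- by rewrite /= (mul_lactbar algA) (mul_lact algA) (Kb b).
Qed.

End Coproduct.

(** The Takeuchi condition on the coproduct of X is exactly what makes factorwise multiplication by
    it well defined. *)
Lemma bal2_mul (G : zmodType) (K : S -> S -> G) X : bal2 K ->
  bal2 (fun y y' : S => dlift (fun x x' => K (x *' y) (x' *' y')) (Delta X)).
Proof.
move=> KP; have [Kl Kr Kb] := KP; split=> [y'|y|b y y'].
- apply: (adm_sum (b0 := S)) => x y z.
  rewrite (linear_addmap (mul_linearr algA _)); exact: Kl.
- apply: (adm_sum (b0 := S)) => x z y'.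
  rewrite (linear_addmap (mul_linearr algA _)); exact: Kr.
- transitivity (dlift (fun x x' => K (ractbar x b *' y) (x' *' y')) (Delta X)).
    by apply: eq_bigr => x _; rewrite (mul_balbar algA).
  rewrite (dlift_takeuchi (bal2_mulr KP y y') b).
  by apply: eq_bigr => x _; rewrite /= (mul_bal algA).
Qed.

Lemma dlift_mul (G : zmodType) (K : S -> S -> G) X Y : bal2 K ->
  dlift K (Delta (X *' Y)) =
  dlift (fun y y' => dlift (fun x x' => K (x *' y) (x' *' y')) (Delta X)) (Delta Y).
Proof.
move=> KP; rewrite (DeltaM cmpA) (addmap_sum _ _ (dliftD KP)).
rewrite [RHS]exchange_big; apply: eq_bigr => x _.
rewrite (addmap_sum _ _ (dliftD KP)); apply: eq_bigr => y _.
by rewrite (dlift_pure KP).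
Qed.

Lemma mul_lact1 X b : X *' lact b (lone A) = ract X b.
Proof. by rewrite -(mul_bal algA) (mulX1 algA). Qed.

Lemma mul_lactbar1 X b : X *' lactbar b (lone A) = ractbar X b.
Proof. by rewrite -(mul_balbar algA) (mulX1 algA). Qed.

(** Right linearity of the coproduct is not an axiom: it comes from X b = X (b 1), multiplicativity,
    and the known coproduct of b 1. *)
Lemma dlift_ract (G : zmodType) (K : S -> S -> G) b (X : L) : bal2 K ->
  dlift K (Delta (ract X b)) = dlift (fun m : S => K (ra m b)) (Delta X).
Proof.
move=> KP; have JP := bal2_mul X KP.
rewrite -mul_lact1 (dlift_mul _ _ KP) Delta_lact (Delta1 cmpA) (dlift_lact JP).
rewrite (dlift_pure (bal2_la b JP)); apply: eq_bigr => x _.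
by rewrite /= mul_lact1 (mulX1 algA).
Qed.

Lemma dlift_ractbar (G : zmodType) (K : S -> S -> G) b (X : L) : bal2 K ->
  dlift K (Delta (ractbar X b)) = dlift (fun m n : S => K m (rb n b)) (Delta X).
Proof.
move=> KP; have JP := bal2_mul X KP.
rewrite -mul_lactbar1 (dlift_mul _ _ KP) Delta_lactbar (Delta1 cmpA).
rewrite (dlift_lactbar JP) (dlift_pure (bal2_lb b JP)); apply: eq_bigr => x _.
by rewrite /= mul_lactbar1 (mulX1 algA).
Qed.

Lemma bal2_DeltaL (G : zmodType) (K : S -> S -> S -> G) : bal3 K ->
  bal2 (fun c c'' : S => dlift (fun x y => K x y c'') (Delta c)).
Proof.
case=> K1 K2 K3 K12 K23; have KP c'' : bal2 (fun x y => K x y c'') by split.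
split=> [c''|c|b c c''].
- by move=> x y; rewrite DeltaD (dliftD (KP c'')).
- by apply: (adm_sum (b0 := S)) => x; apply: K3.
- rewrite /= Delta_lactbar (dlift_lactbar (KP c'')).
  by apply: eq_bigr => x _; apply: K23.
Qed.

Lemma bal2_DeltaR (G : zmodType) (K : S -> S -> S -> G) : bal3 K ->
  bal2 (fun c c' : S => dlift (K c) (Delta c')).
Proof.
move=> KP3; have KP c := bal3_bal2 c KP3; have [K1 K2 K3 K12 K23] := KP3.
split=> [c'|c|b c c'].
- by apply: (adm_sum (b0 := S)) => x; apply: K1.
- by move=> x y; rewrite DeltaD (dliftD (KP c)).
- rewrite /= Delta_lact (dlift_lact (KP c)).
  by apply: eq_bigr => x _; apply: K12.
Qed.

Lemma dlift_coassoc (G : zmodType) (K : S -> S -> S -> G) (X : L) : bal3 K ->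
  dlift (fun c c'' => dlift (fun x y => K x y c'') (Delta c)) (Delta X) =
  dlift (fun c c' => dlift (K c) (Delta c')) (Delta X).
Proof.
move=> KP; have [_ _ XE] := Delta_coassoc X.
pose r := [seq (y.1, y.2, x.2) | x <- rep2 (Delta X), y <- rep2 (Delta x.1)].
pose r' := [seq (x.1, y.1, y.2) | x <- rep2 (Delta X), y <- rep2 (Delta x.2)].
have rE : \sum_(x <- r) pure3 x.1.1 x.1.2 x.2 =
    \sum_(x <- r') pure3 x.1.1 x.1.2 x.2 by rewrite !big_allpairs_dep.
by have := diamond3_sum_eq KP rE; rewrite !big_allpairs_dep.
Qed.

(** Every b is the counit of b 1, and for Y = b 1 both sides are eps(XY). *)
Lemma eps_rab (X : L) b : eps (ract X b) = eps (ractbar X b).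
Proof.
have {1 2}<- : eps (lact b (lone A)) = b by rewrite eps_lact (eps1 cmpA) mulr1.
by rewrite (eps_ract cmpA) (eps_ractbar cmpA).
Qed.

Variable d : L -> seq (L * L).
Hypothesis dP : sweedler_choice d.

Lemma sweedler_sum (G : zmodType) (K : S -> S -> G) X : bal2 K ->
  \sum_(x <- d X) K x.1 x.2 = dlift K (Delta X).
Proof. by move=> KP; rewrite dP (dlift_sum KP). Qed.

(** The choice d of representatives stays a parameter, so that two choices can later be compared by
    a morphism. *)
Definition bialg_coalg : coalg B.
Proof.
refine (@Coalg B S d (@eps k B L) _ _ _ _ _ _ _ _ _ _ _ _ _).
- by move=> G K KP X Y; rewrite !(sweedler_sum _ KP) DeltaD (dliftD KP).
- move=> G K b X KP; rewrite (sweedler_sum _ KP) Delta_lact (dlift_lact KP).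
  by rewrite -(sweedler_sum _ (bal2_la b KP)).
- move=> G K b X KP; rewrite (sweedler_sum _ KP) Delta_lactbar (dlift_lactbar KP).
  by rewrite -(sweedler_sum _ (bal2_lb b KP)).
- move=> G K X b KP; rewrite (sweedler_sum _ KP) (dlift_ract _ _ KP).
  have [Kl Kr Kb] := KP.
  rewrite -(sweedler_sum (K := fun m : S => K (ra m b))) //; split=> // [c'|c c' c''].
  + exact: (adm_ra (b0 := S) b (Kl c')).
  + by rewrite -lb_ra Kb.
- move=> G K X b KP; rewrite (sweedler_sum _ KP) (dlift_ractbar _ _ KP).
  have [Kl Kr Kb] := KP.
  rewrite -(sweedler_sum (K := fun m n : S => K m (rb n b))) //; split=> // [c|c c' c''].
  + exact: (adm_rb (b0 := S) b (Kr c)).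
  + by rewrite -la_rb Kb.
- move=> G K X b KP; have [Kl Kr Kb] := KP.
  rewrite (sweedler_sum (K := fun m : S => K (rb m b))); last first.
    split=> // [c'|c c' c'']; first exact: (adm_rb (b0 := S) b (Kl c')).
    by rewrite -lb_rb Kb.
  rewrite (sweedler_sum (K := fun m n : S => K m (ra n b))); last first.
    split=> // [c|c c' c'']; first exact: (adm_ra (b0 := S) b (Kr c)).
    by rewrite -la_ra Kb.
  exact: dlift_takeuchi.
- move=> G K X KP; have K3 := bal2_DeltaL KP; have K1 := bal2_DeltaR KP.
  have [k1 k2 k3 k12 k23] := KP.
  have KL c'' : bal2 (fun x y => K x y c'') by split.
  under eq_bigr do rewrite (sweedler_sum _ (KL _)).
  under [RHS]eq_bigr do rewrite (sweedler_sum _ (bal3_bal2 _ KP)).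
  rewrite (sweedler_sum _ K3) (sweedler_sum _ K1).
  exact: dlift_coassoc.
- exact: (linear_addmap (@eps_linear k B L)).
- exact: eps_lact.
- exact: eps_lactbar.
- exact: eps_rab.
- move=> G f X fP.
  have KP : bal2 (fun c c' : S => f (la (eps c) c')).
    split=> [c' x y|c|b c c'].
    + rewrite (linear_addmap (@eps_linear k B L)).
      exact: (adm_laD (b0 := S) c' fP).
    + exact: (adm_la (b0 := S) _ fP).
    + by rewrite /= eps_lactbar lactM.
  rewrite (sweedler_sum _ KP) -[in RHS](counitl X).
  by rewrite (addmap_sum _ _ (fP : addmap f)).
- move=> G f X fP.
  have KP : bal2 (fun c c' : S => f (lb (eps c') c)).
    split=> [c'|c x y|b c c'].
    + exact: (adm_lb (b0 := S) _ fP).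
    + rewrite (linear_addmap (@eps_linear k B L)).
      exact: (adm_lbD (b0 := S) c fP).
    + by rewrite /= eps_lact lactbarM.
  rewrite (sweedler_sum _ KP) -[in RHS](counitr X).
  by rewrite (addmap_sum _ _ (fP : addmap f)).
Defined.

Local Notation C := bialg_coalg.

Definition bialg_mul : cmor (C ** C) C.
Proof.
refine (@Cmor B (C ** C) C (fun p => p.1 *' p.2) _ _ _ _ _ _ _).
- move=> G f fD; split=> [y|x|x b y|x b y] /=.
  + by move=> u v; rewrite (linear_addmap (mul_linearl algA y)) fD.
  + by move=> u v; rewrite (linear_addmap (mul_linearr algA x)) fD.
  + by rewrite (mul_bal algA).
  + by rewrite (mul_balbar algA).
- by move=> G f b [x y] _ /=; rewrite (mul_lact algA).
- by move=> G f b [x y] _ /=; rewrite (mul_lactbar algA).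
- by move=> G f [x y] b _ /=; rewrite (mul_ract algA).
- by move=> G f [x y] b _ /=; rewrite (mul_ractbar algA).
- move=> G K [X Y] KP; rewrite (tens_sumE (fun z z' : C ** C =>
    K (z.1 *' z.2) (z'.1 *' z'.2))) (sweedler_sum _ KP) (dlift_mul _ _ KP).
  rewrite -(sweedler_sum _ (bal2_mul X KP)); apply: eq_bigr => y _.
  by rewrite (sweedler_sum _ (bal2_mulr KP y.1 y.2)).
- by move=> [X Y] /=; rewrite -(eps_ract cmpA).
Defined.

Lemma lone_unit : unit_gen (lone A : C).
Proof.
split=> [G K KP||b|b].
- by rewrite (sweedler_sum _ KP) (Delta1 cmpA) (dlift_pure KP).
- exact: eps1.
- by rewrite /= -mul_lact1 (mul1X algA).
- by rewrite /= -mul_lactbar1 (mul1X algA).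
Qed.

End Bialgebroid.

(** * The twisted product is a morphism of coalgebroids *)

Section PureHom.
Variables (k : fieldType) (B : algType k) (M : be_bimod B) (C : coalg B).
Local Notation S := (bimod_bispace M).
Local Notation R := (breg B).
Local Notation DD := (diamond_bmod M).
Implicit Types F : hom C (bimod_bmod M).

Lemma adm_purel F n : adm (fun c => pure2 (F c : M) n : diamond M M).
Proof.
exact: (@adm_comp B C (bimod_bmod M) (diamond_bmod M)
  (fun m => pure2 (m : M) n) F (bal2l (pure2_bal M) n) (h_adm F)).
Qed.

Lemma adm_purer m F : adm (fun c => pure2 m (F c : M) : diamond M M).
Proof.
exact: (@adm_comp B C (bimod_bmod M) (diamond_bmod M)
  (fun n => pure2 m (n : M)) F (bal2r (pure2_bal M) m) (h_adm F)).
Qed.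

Lemma pure2_mlb b (m n : M) :
  pure2 (lactbar b m) n = pure2 m (lact b n) :> diamond M M.
Proof. exact: (bal2b (pure2_bal M)). Qed.

Lemma pure_hom_bal2 F F' : bal2 (fun c c' => pure2 (F c) (F' c') : diamond M M).
Proof.
split=> [c'|c|b c c']; [exact: adm_purel | exact: adm_purer |].
by rewrite h_lb h_la; apply: pure2_mlb.
Qed.

(** Comultiplicativity of an L-valued map F on C reads [delta_hom F = pure_hom F F]. *)
Definition pure_hom F F' : hom C (diamond_bmod M).
Proof.
refine (@Hom _ C (diamond_bmod M)
  (fun c => \sum_(x <- cop c) pure2 (F x.1) (F' x.2))
  (cop_adm (pure_hom_bal2 F F')) _ _) => b c.
- rewrite (cop_la _ _ (pure_hom_bal2 F F')) (addmap_sum _ _ (mlaDr b)).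
  by apply: eq_bigr => x _; rewrite h_la /= diamond_lact_pure.
- rewrite (cop_lb _ _ (pure_hom_bal2 F F')) (addmap_sum _ _ (mlbDr b)).
  by apply: eq_bigr => x _; rewrite h_lb /= diamond_lactbar_pure.
Defined.

Lemma pure_hom_lconv (u : hom C R) F F' :
  pure_hom (lconv u F) F' = lconv u (pure_hom F F').
Proof.
apply: hom_eq => c /=.
pose K (c c' c'' : C) := mla (u c : B) (pure2 (F c') (F' c'') : DD).
have KP : bal3 K.
  split=> [c' c''|c1 c''|c1 c'|b c1 c' c''|b c1 c' c''].
  - exact: adm_mlal.
  - exact: (@adm_mlar _ _ DD _ _ (adm_purel F (F' c''))).
  - exact: (@adm_mlar _ _ DD _ _ (adm_purer (F c') F')).
  - rewrite /K h_lb h_la; apply: (etrans (mlaM (b0 := DD) _ _ _)).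
    by congr mla; apply: diamond_lact_pure.
  - by rewrite /K h_lb h_la; congr mla; apply: pure2_mlb.
transitivity (\sum_(x <- cop c) \sum_(y <- cop x.1) K y.1 y.2 x.2).
  apply: eq_bigr => x _.
  rewrite (addmap_sum _ _ (bal2l (pure2_bal M) (F' x.2) : addmap (fun m : M => pure2 m (F' x.2)))).
  by apply: eq_bigr => y _; rewrite /K /= diamond_lact_pure.
rewrite (copA _ KP); apply: eq_bigr => x _.
by rewrite (addmap_sum _ _ (diamond_lactD (M := M) (u x.1))).
Qed.

Lemma pure_hom_rconv (u : hom C R) F F' :
  pure_hom F (rconv F' u) = rconv (pure_hom F F') u.
Proof.
apply: hom_eq => c /=.
pose K (c c' c'' : C) := mlb (u c'' : B) (pure2 (F c) (F' c') : DD).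
have KP : bal3 K.
  split=> [c' c''|c1 c''|c1 c'|b c1 c' c''|b c1 c' c''].
  - exact: (@adm_mlbr _ _ DD _ _ (adm_purel F (F' c'))).
  - exact: (@adm_mlbr _ _ DD _ _ (adm_purer (F c1) F')).
  - exact: adm_mlbl.
  - by rewrite /K h_lb h_la; congr mlb; apply: pure2_mlb.
  - rewrite /K h_lb h_la; apply/esym/(etrans (mlbM (b0 := DD) _ _ _)).
    by congr mlb; apply: diamond_lactbar_pure.
transitivity (\sum_(x <- cop c) \sum_(y <- cop x.2) K x.1 y.1 y.2).
  apply: eq_bigr => x _.
  rewrite (addmap_sum _ _ (bal2r (pure2_bal M) (F x.1) : addmap (fun m : M => pure2 (F x.1) m))).
  by apply: eq_bigr => y _; rewrite /K /= diamond_lactbar_pure.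
rewrite -(copA _ KP); apply: eq_bigr => x _.
by rewrite (addmap_sum _ _ (diamond_lactbarD (M := M) (u x.2))).
Qed.

(** A cochain slides across the tensor sign because \bar b m \otimes n = m \otimes b n in the
    diamond product. *)
Lemma pure_hom_mid (u : hom C R) F F' :
  pure_hom (rconv F u) F' = pure_hom F (lconv u F').
Proof.
apply: hom_eq => c /=.
pose K (c c' c'' : C) := pure2 (F c) (lact (u c') (F' c'')) : diamond_bmod M.
have KE x y z : K x y z = pure2 (lactbar (u y) (F x)) (F' z).
  by rewrite pure2_mlb.
have KP : bal3 K.
  split=> [c' c''|c1 c''|c1 c'|b c1 c' c''|b c1 c' c''].
  - exact: adm_purel.
  - apply: (@adm_comp B C (breg B) (diamond_bmod M)
      (fun b : B => pure2 (F c1) (lact b (F' c''))) u) (h_adm u) => x y.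
    rewrite (linear_addmap (lact_linearl _)).
    exact: (bal2r (pure2_bal M) (F c1)).
  - apply: (@adm_comp B C (bimod_bmod M) (diamond_bmod M)
      (fun m => pure2 (F c1) (lact (u c') m)) F') (h_adm F') => x y.
    rewrite (linear_addmap (lact_linearr _)).
    exact: (bal2r (pure2_bal M) (F c1)).
  - by rewrite /K h_lb h_la /= pure2_mlb lactM.
  - by rewrite /K h_lb h_la /= lactM.
transitivity (\sum_(x <- cop c) \sum_(y <- cop x.1) K y.1 y.2 x.2).
  apply: eq_bigr => x _.
  rewrite (addmap_sum _ _ (bal2l (pure2_bal M) (F' x.2) : addmap (fun m : M => pure2 m (F' x.2)))).
  by apply: eq_bigr => y _; rewrite KE.
rewrite (copA _ KP); apply: eq_bigr => x _.
by rewrite (addmap_sum _ _ (bal2r (pure2_bal M) (F x.1) : addmap (fun m : M => pure2 (F x.1) m))).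
Qed.

End PureHom.

Section PostComposition.
Variables (B : nzRingType) (C : coalg B) (M N : bmod B) (g : M -> N).
Hypotheses (gD : addmap g) (gla : forall b m, g (mla b m) = mla b (g m))
  (glb : forall b m, g (mlb b m) = mlb b (g m)).

Definition post (F : hom C M) : hom C N.
Proof.
refine (@Hom _ C N (fun c => g (F c)) (adm_comp gD (h_adm F)) _ _) => b c.
- by rewrite h_la gla.
- by rewrite h_lb glb.
Defined.

Lemma post_lconv (u : hom C (breg B)) F :
  post (lconv u F) = lconv u (post F).
Proof.
apply: hom_eq => c /=; rewrite (addmap_sum _ _ gD).
by apply: eq_bigr => x _; rewrite gla.
Qed.

Lemma post_rconv (u : hom C (breg B)) F :
  post (rconv F u) = rconv (post F) u.
Proof.
apply: hom_eq => c /=; rewrite (addmap_sum _ _ gD).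
by apply: eq_bigr => x _; rewrite glb.
Qed.

End PostComposition.

Section TwistedMorphism.
Variables (k : fieldType) (B : algType k) (L : coalgebroid B) (A : alg_data L).
Hypotheses (algA : is_algebra_over A) (cmpA : is_compatible A).
Variable d : L -> seq (L * L).
Hypothesis dP : sweedler_choice d.
Local Notation C := (bialg_coalg algA cmpA dP).
Local Notation M := (bimod_bmod L).
Variables (D : coalg B) (f : cmor D C) (u u' : dual D).
Hypotheses (uu' : dmul u u' = dunit D) (u'u : dmul u' u = dunit D).

Definition id_hom : hom C M.
Proof. by refine (@Hom _ C M id _ _ _). Defined.

Local Notation F := (pull f id_hom).

Definition twist_hom : hom D M := lconv u (rconv F u').

Lemma twist_hom_ra c b : twist_hom (ra c b) = ract (twist_hom c) b.
Proof.
rewrite (lconv_ra _ _ _ (dualP u)).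
rewrite [RHS](addmap_sum _ _ (linear_addmap (ract_linearl b))).
apply: eq_bigr => x _; rewrite rconv_ra /= -lact_ract; congr lact.
rewrite [RHS](addmap_sum _ _ (linear_addmap (ract_linearl b))).
apply: eq_bigr => y _; rewrite -lactbar_ract; congr lactbar.
exact: (c_ra f y.1 b (h_adm id_hom)).
Qed.

Lemma twist_hom_rb c b : twist_hom (rb c b) = ractbar (twist_hom c) b.
Proof.
rewrite lconv_rb.
rewrite [RHS](addmap_sum _ _ (linear_addmap (ractbar_linearl b))).
apply: eq_bigr => x _; rewrite (rconv_rb _ _ _ (dualP u')) /= -lact_ractbar.
congr lact.
rewrite [RHS](addmap_sum _ _ (linear_addmap (ractbar_linearl b))).
apply: eq_bigr => y _; rewrite -lactbar_ractbar; congr lactbar.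
exact: (c_rb f y.1 b (h_adm id_hom)).
Qed.

(** Used with j the insertion of the unit on either side: there the twist is invisible, so 1 remains
    a unit for the twisted product. *)
Lemma twist_hom_trivial D' (j : cmor D' D) c :
  dpull j u = dunit D' -> dpull j u' = dunit D' -> twist_hom (j c) = f (j c).
Proof.
move=> ju ju'; rewrite -[LHS]/(pull j twist_hom c) /twist_hom.
rewrite pull_lconv pull_rconv.
rewrite -[pull j u]/(dfun (dpull j u)) -[pull j u']/(dfun (dpull j u')) ju ju'.
by rewrite [lconv _ _]lconv1 [rconv _ _]rconv1.
Qed.

Definition delta_hom (H : hom D M) : hom D (diamond_bmod L) :=
  @post B D M (diamond_bmod L) (@Delta k B L) (@DeltaD k B L)
    (@Delta_lact k B L) (@Delta_lactbar k B L) H.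

Definition eps_hom (H : hom D M) : hom D (breg B) :=
  @post B D M (breg B) (@eps k B L) (linear_addmap (@eps_linear k B L))
    (@eps_lact k B L) (@eps_lactbar k B L) H.

(** The coproduct of u * f * u' is (u * f) \otimes (f * u'). Inserting u' * u = 1 at the tensor sign
    completes both factors to u * f * u'. *)
Lemma delta_twist : delta_hom twist_hom = pure_hom twist_hom twist_hom.
Proof.
have FE : delta_hom F = pure_hom F F.
  apply: hom_eq => c; rewrite /= dP.
  exact: (c_cop f c (pure2_bal L)).
have -> : delta_hom twist_hom = lconv u (rconv (delta_hom F) u').
  by rewrite /delta_hom /twist_hom post_lconv post_rconv.
rewrite FE /twist_hom pure_hom_lconv pure_hom_mid -(lconv_dmul u' u).
by rewrite u'u lconv1 pure_hom_rconv.
Qed.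

Lemma eps_twist c : eps (twist_hom c) = cou c.
Proof.
have -> : eps (twist_hom c) = eps_hom twist_hom c by [].
have -> : eps_hom twist_hom = lconv u (rconv (eps_hom F) u').
  by rewrite /eps_hom /twist_hom post_lconv post_rconv.
have -> : eps_hom F = hcou D by apply: hom_eq => x; apply: (c_cou f).
by rewrite rconvR lconv1 -[lconv u u']/(dfun (dmul u u')) uu'.
Qed.

Definition twist_cmor : cmor D C.
Proof.
refine (@Cmor B D C twist_hom _ _ _ _ _ _ _).
- move=> G h hD; exact: (adm_comp (hD : addmap h) (h_adm twist_hom)).
- by move=> G h b c _; rewrite h_la.
- by move=> G h b c _; rewrite h_lb.
- by move=> G h c b _; rewrite twist_hom_ra.
- by move=> G h c b _; rewrite twist_hom_rb.
- move=> G K c KP; rewrite (sweedler_sum dP _ KP).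
  rewrite -[Delta _]/(delta_hom twist_hom c) delta_twist.
  rewrite (addmap_sum _ _ (dliftD KP)); apply: eq_bigr => x _.
  by rewrite (dlift_pure KP).
- exact: eps_twist.
Defined.

Lemma twist_sconj : sconj_by twist_cmor f u u'.
Proof.
move=> G K c KD; rewrite [LHS](addmap_sum _ _ (KD : addmap K)).
apply: eq_bigr => x _; rewrite /=.
rewrite (addmap_sum _ _ (linear_addmap (lact_linearr _))).
by rewrite (addmap_sum _ _ (KD : addmap K)).
Qed.

End TwistedMorphism.

(** * Explicit Sweedler sums *)

Lemma addmap_linear (R : nzRingType) (U V : lmodType R) (f : U -> V) :
  addmap f -> (forall a x, f (a *: x) = a *: f x) -> linear f.
Proof. by move=> fD fZ a x y; rewrite fD fZ. Qed.

Lemma sweedler_cop2 (k : fieldType) (B : algType k) (L : coalgebroid B) :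
  sweedler_choice (@cop2 k B L).
Proof. by move=> X; rewrite [RHS]rep2P. Qed.

Section ExchangeSums.
Variables (G : zmodType) (I1 I2 J1 J2 J3 K1 K2 : Type).
Variables (r1 : seq I1) (r2 : I1 -> seq I2).
Variables (s1 : seq J1) (s2 : J1 -> seq J2) (s3 : J2 -> seq J3).
Variables (t1 : seq K1) (t2 : K1 -> seq K2).
Variable F : I1 -> I2 -> J1 -> J2 -> J3 -> K1 -> K2 -> G.

(** The left side is the order of summation in [coboundary_of], the right side the order produced by
    expanding the four-fold convolution product. *)
Lemma exchange_big223 :
  \sum_(x <- r1) \sum_(x' <- r2 x) \sum_(y <- s1) \sum_(y' <- s2 y)
    \sum_(y'' <- s3 y') \sum_(z <- t1) \sum_(z' <- t2 z) F x x' y y' y'' z z' =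
  \sum_(z <- t1) \sum_(y <- s1) \sum_(z' <- t2 z) \sum_(y' <- s2 y)
    \sum_(x <- r1) \sum_(y'' <- s3 y') \sum_(x' <- r2 x) F x x' y y' y'' z z'.
Proof.
transitivity (\sum_(x <- r1) \sum_(x' <- r2 x) \sum_(z <- t1) \sum_(y <- s1)
    \sum_(y' <- s2 y) \sum_(z' <- t2 z) \sum_(y'' <- s3 y') F x x' y y' y'' z z').
  apply: eq_bigr => x _; apply: eq_bigr => x' _.
  rewrite [RHS]exchange_big; apply: eq_bigr => y _.
  rewrite [RHS]exchange_big; apply: eq_bigr => y' _ /=.
  rewrite exchange_big; apply: eq_bigr => z _; exact: exchange_big.
transitivity (\sum_(z <- t1) \sum_(y <- s1) \sum_(y' <- s2 y) \sum_(z' <- t2 z)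
    \sum_(x <- r1) \sum_(x' <- r2 x) \sum_(y'' <- s3 y') F x x' y y' y'' z z').
  do 4!(under eq_bigr do rewrite exchange_big; rewrite exchange_big;
        apply: eq_bigr => ? _) => //.
apply: eq_bigr => z _; apply: eq_bigr => y _.
rewrite exchange_big; apply: eq_bigr => z' _; apply: eq_bigr => y' _.
by apply: eq_bigr => x _; rewrite exchange_big.
Qed.

End ExchangeSums.

Section Explicit.
Variables (k : fieldType) (B : algType k) (L : coalgebroid B) (A : alg_data L).
Hypotheses (algA : is_algebra_over A) (cmpA : is_compatible A).
Local Notation R := (breg B).
Local Notation "X *' Y" := (lmul A X Y) (at level 40, left associativity).

Section Choice.
Variable d : L -> seq (L * L).
Hypothesis dP : sweedler_choice d.
Local Notation C := (bialg_coalg algA cmpA dP).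
Local Notation m := (bialg_mul algA cmpA dP).

Definition hom2_hom (f : L -> L -> B) (fP : hom2 f) : hom (C ** C) R.
Proof.
refine (@Hom B (C ** C) R (fun p => f p.1 p.2) _ _ _).
- split=> [y|x|x b y|x b y].
  + exact: (linear_addmap (hom2_linearl fP y)).
  + exact: (linear_addmap (hom2_linearr fP x)).
  + exact: (hom2_bal fP).
  + exact: (hom2_balbar fP).
- by move=> b c; apply: (hom2_lact fP).
- by move=> b c; apply: (hom2_lactbar fP).
Defined.

(** Only k-linearity is hidden in a [hom]: in the first variable it follows from left B-linearity,
    and balancing transfers it to the second variable and then to the third. *)
Lemma hom3_hom (u : hom (C ** C ** C) R) : hom3 (fun X Y Z => u ((X, Y), Z)).
Proof.
have [u1 u2 u3 u4] := h_adm u.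
have bal12 Z := tens_bal (u1 Z); have bal12' Z := tens_balbar (u1 Z).
have bal23 X b Y Z : u ((X, ract Y b), Z) = u ((X, Y), lact b Z).
  exact: (u3 (X, Y)).
have Z1 (a : k) X Y Z : u ((a *: X, Y), Z) = a *: u ((X, Y), Z).
  have -> : a *: X = lact (a%:A) X by rewrite lact_scale.
  rewrite [LHS](h_la u (a%:A) ((X, Y), Z)).
  by rewrite -[mla _ _]/(a%:A * _) -scalerAl mul1r.
have Z2 (a : k) X Y Z : u ((X, a *: Y), Z) = a *: u ((X, Y), Z).
  rewrite -Z1 -(ract_scale a X) [RHS](bal12 Z X (a%:A) Y).
  by rewrite -[la _ _]/(lact (a%:A) Y) lact_scale.
have Z3 (a : k) X Y Z : u ((X, Y), a *: Z) = a *: u ((X, Y), Z).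
  by rewrite -Z2 -(ract_scale a Y) bal23 lact_scale.
split.
- by move=> Y Z; apply: addmap_linear => // x y; apply: (tens_adml (u1 Z) Y).
- by move=> X Z; apply: addmap_linear => // x y; apply: (tens_admr (u1 Z) X).
- by move=> X Y; apply: addmap_linear => // x y; apply: (u2 (X, Y)).
- by move=> X b Y Z; apply: bal12.
- by move=> X b Y Z; apply: bal12'.
- by move=> X Y b Z; apply: bal23.
- by move=> X Y b Z; apply: (u4 (X, Y)).
- by move=> b X Y Z; apply: (h_la u b ((X, Y), Z)).
- by move=> b X Y Z; apply: (h_lb u b ((X, Y), Z)).
Qed.

Variables (S S' : L -> L -> B) (s s' : dual (C ** C)).
Hypotheses (sE : forall p, s p = S p.1 p.2) (s'E : forall p, s' p = S' p.1 p.2).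

Lemma twist_mul_ofE X Y : twist_mul_of A d S S' X Y = twist_hom m s s' (X, Y).
Proof.
rewrite -[RHS]/(\sum_(z <- cop ((X, Y) : C ** C)) (fun z z' =>
  lact (s z) (\sum_(w <- cop z') lactbar (s' w.2) (w.1.1 *' w.1.2))) z.1 z.2).
rewrite tens_sumE exchange_big /twist_mul_of big_allpairs_dep.
apply: eq_bigr => x _.
transitivity (\sum_(y <- d Y) \sum_(x' <- d x.2) \sum_(y' <- d y.2)
   lact (S x.1 y.1) (lactbar (S' x'.2 y'.2) (x'.1 *' y'.1))).
  rewrite [RHS]exchange_big; apply: eq_bigr => x' _.
  by rewrite big_allpairs_dep.
apply: eq_bigr => y _; rewrite sE /=.
rewrite (tens_sumE (fun w w' : C ** C => lactbar (s' w') (w.1 *' w.2))).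
rewrite (addmap_sum _ _ (linear_addmap (lact_linearr _))) exchange_big /=.
apply: eq_bigr => y' _.
rewrite (addmap_sum _ _ (linear_addmap (lact_linearr _))).
by apply: eq_bigr => x' _; rewrite s'E.
Qed.

Lemma coboundary_ofE X Y Z :
  coboundary_of A d S S' X Y Z = drinfeld m s s' ((X, Y), Z).
Proof.
(* After rebracketing, the leading factor is 1 \otimes s, [P] is the twist on (X, YZ), and [Q]
   collects the two inverse factors. *)
pose P := dpull (tmor (idmor C) m) s.
pose Q := dpull (tassocV C C C) (dmul (e12_3 m s') (e12 s')).
have PQ : dpull (tassocV C C C) (drinfeld m s s') =
    dmul (tdual (dunit C) s) (dmul P Q).
  rewrite /drinfeld /Q !dpullM -dmulA.
  have -> : dpull (tassocV C C C) (e23 s) = tdual (dunit C) s.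
    by apply: dual_eq => -[x [y z]].
  have -> // : dpull (tassocV C C C) (e1_23 m s) = P.
  by apply: dual_eq => -[x [y z]].
have QE x q : Q (x, q) = \sum_(y' <- d q.1) \sum_(x' <- d x)
    S' (lactbar (S' x'.2 y'.2) (x'.1 *' y'.1)) q.2.
  case: q => y z; rewrite -[LHS]/(lconv (e12_3 m s') (tdual s' (dunit C)) ((x, y), z)) -rconvR.
  rewrite rconv_tdual1 (rconv_tens _ (tslice _ _)).
  apply: eq_bigr => y' _; apply: eq_bigr => x' _ /=.
  by rewrite -[LHS](h_lb s' (s' (x'.2, y'.2)) (x'.1 *' y'.1, z)) !s'E.
rewrite -[RHS]/(dpull (tassocV C C C) (drinfeld m s s') (X, (Y, Z))) PQ.
rewrite -[RHS]/(lconv (tdual (dunit C) s) (lconv P Q) (X, (Y, Z))).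
rewrite lconv_1tdual.
transitivity (\sum_(p <- cop ((Y, Z) : C ** C)) \sum_(q <- cop p.2)
    \sum_(x <- d X) \sum_(y' <- d q.2.1) \sum_(x' <- d x.2)
    S x.1 (lact (S p.1.1 p.1.2) (q.1.1 *' q.1.2)) *
    S' (lactbar (S' x'.2 y'.2) (x'.1 *' y'.1)) q.2.2); last first.
  apply: eq_bigr => p _; rewrite lconv_tens_la.
  apply: eq_bigr => q _; apply: eq_bigr => x _.
  rewrite QE /= !sE /= (mul_lact algA) mulr_sumr; apply: eq_bigr => y' _.
  by rewrite mulr_sumr.
rewrite (tens_sumE (fun p r : C ** C => \sum_(q <- cop r)
    \sum_(x <- d X) \sum_(y' <- d q.2.1) \sum_(x' <- d x.2)
    S x.1 (lact (S p.1 p.2) (q.1.1 *' q.1.2)) *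
    S' (lactbar (S' x'.2 y'.2) (x'.1 *' y'.1)) q.2.2)).
transitivity (\sum_(z <- d Z) \sum_(y <- d Y) \sum_(z' <- d z.2)
    \sum_(y' <- d y.2) \sum_(x <- d X) \sum_(y'' <- d y'.2)
    \sum_(x' <- d x.2) S x.1 (lact (S y.1 z.1) (y'.1 *' z'.1)) *
    S' (lactbar (S' x'.2 y''.2) (x'.1 *' y''.1)) z'.2); last first.
  apply: eq_bigr => z _; apply: eq_bigr => y _.
  by rewrite (tens_sumE (fun q1 q2 : C ** C => \sum_(x <- d X)
    \sum_(y' <- d q2.1) \sum_(x' <- d x.2)
    S x.1 (lact (S y.1 z.1) (q1.1 *' q1.2)) *
    S' (lactbar (S' x'.2 y'.2) (x'.1 *' y'.1)) q2.2)).
rewrite -exchange_big223 /coboundary_of big_allpairs_dep.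
apply: eq_bigr => x _; apply: eq_bigr => x' _.
rewrite big_allpairs_dep; apply: eq_bigr => y _.
rewrite big_allpairs_dep; apply: eq_bigr => y' _; apply: eq_bigr => y'' _.
by rewrite big_allpairs_dep.
Qed.

End Choice.
End Explicit.

(** * Naturality, and summation over tensor powers *)

Lemma drinfeld_pull (B : nzRingType) (C C' : coalg B) (m : cmor (C ** C) C)
    (m' : cmor (C' ** C') C') (i : cmor C C') s s' :
  (forall p, i (m p) = m' (i p.1, i p.2)) ->
  dpull (tmor (tmor i i) i) (drinfeld m' s s') =
  drinfeld m (dpull (tmor i i) s) (dpull (tmor i i) s').
Proof.
move=> im; rewrite /drinfeld !dpullM; set j := tmor (tmor i i) i.
have -> : dpull j (e23 s) = e23 (dpull (tmor i i) s).
  apply: dual_eq => -[[x y] z] /=.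
  by rewrite /tens_cou /= -(c_ra i x _ (cou_adm C')) c_cou.
have -> : dpull j (e1_23 m' s) = e1_23 m (dpull (tmor i i) s).
  by apply: dual_eq => -[[x y] z] /=; rewrite im.
have -> : dpull j (e12_3 m' s') = e12_3 m (dpull (tmor i i) s').
  by apply: dual_eq => -[[x y] z] /=; rewrite im.
have -> // : dpull j (e12 s') = e12 (dpull (tmor i i) s').
apply: dual_eq => -[[x y] z] /=; rewrite c_cou.
exact: esym (c_ra i y _ (tens_admr (h_adm s') (i x))).
Qed.

Lemma drinfeld_pullE (B : nzRingType) (C C' : coalg B) (m : cmor (C ** C) C)
    (m' : cmor (C' ** C') C') (i : cmor C C') (s s' : dual (C' ** C'))
    (t t' : dual (C ** C)) x y z :
  (forall p, i (m p) = m' (i p.1, i p.2)) ->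
  (forall p, t p = s (i p.1, i p.2)) -> (forall p, t' p = s' (i p.1, i p.2)) ->
  drinfeld m t t' ((x, y), z) = drinfeld m' s s' ((i x, i y), i z).
Proof.
move=> im ts ts'.
have -> : t = dpull (tmor i i) s by apply: dual_eq => p; rewrite ts.
have -> : t' = dpull (tmor i i) s' by apply: dual_eq => p; rewrite ts'.
by rewrite -(drinfeld_pull s s' im).
Qed.

(** Naturality of the twisted map. The two ends may use different representatives of the coproduct;
    with j the identity on elements this yields independence of the choice. *)
Lemma twist_hom_pullE (k : fieldType) (B : algType k) (L : coalgebroid B)
    (A : alg_data L) (algA : is_algebra_over A) (cmpA : is_compatible A)
    (d d' : L -> seq (L * L)) (dP : sweedler_choice d) (dP' : sweedler_choice d')
    (D D' : coalg B) (f : cmor D (bialg_coalg algA cmpA dP))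
    (f' : cmor D' (bialg_coalg algA cmpA dP')) (j : cmor D D')
    (u u' : dual D) (v v' : dual D') c :
  (forall c, f c = f' (j c) :> L) ->
  (forall c, u c = v (j c)) -> (forall c, u' c = v' (j c)) ->
  twist_hom f u u' c = twist_hom f' v v' (j c).
Proof.
move=> fE uE u'E.
have -> : u = dpull j v by apply: dual_eq.
have -> : u' = dpull j v' by apply: dual_eq.
rewrite -[RHS]/(pull j (twist_hom f' v v') c) /twist_hom pull_lconv pull_rconv.
have -> // : pull f (id_hom algA cmpA dP) = pull j (pull f' (id_hom algA cmpA dP')).
exact: hom_eq.
Qed.

Lemma tens2_sumE (B : nzRingType) (C D : coalg B) (G : zmodType)
    (K : C ** D -> C ** D -> G) c d :
  \sum_(w <- cop ((c, d) : C ** D)) K w.1 w.2 =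
  \sum_(x <- cop c) \sum_(y <- cop d) K (x.1, y.1) (x.2, y.2).
Proof. by rewrite tens_sumE exchange_big. Qed.

Lemma tens3_sumE (B : nzRingType) (C D E : coalg B) (G : zmodType)
    (K : C ** D ** E -> C ** D ** E -> G) c d e :
  \sum_(w <- cop (((c, d), e) : C ** D ** E)) K w.1 w.2 =
  \sum_(x <- cop c) \sum_(y <- cop d) \sum_(z <- cop e)
    K ((x.1, y.1), z.1) ((x.2, y.2), z.2).
Proof.
rewrite tens2_sumE; exact: (tens2_sumE (fun v v' : C ** D =>
  \sum_(z <- cop e) K (v, z.1) (v', z.2))).
Qed.

Lemma tens4_sumE (B : nzRingType) (C D E F : coalg B) (G : zmodType)
    (K : C ** D ** E ** F -> C ** D ** E ** F -> G) c d e f :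
  \sum_(w <- cop ((((c, d), e), f) : C ** D ** E ** F)) K w.1 w.2 =
  \sum_(x <- cop c) \sum_(y <- cop d) \sum_(z <- cop e) \sum_(t <- cop f)
    K (((x.1, y.1), z.1), t.1) (((x.2, y.2), z.2), t.2).
Proof.
rewrite tens2_sumE; exact: (tens3_sumE (fun v v' : C ** D ** E =>
  \sum_(t <- cop f) K (v, t.1) (v', t.2))).
Qed.

(** * The twist as an invertible cochain on a left bialgebroid *)

Section FinalAssembly.
Variables (k : fieldType) (B : algType k) (L : coalgebroid B) (A : alg_data L).
Variables S S' : L -> L -> B.
Hypotheses (bialgA : bialgebroid A) (C2S : in_C2 A S).
Hypothesis SS' : conv_inverse2 A S S'.

Let algA := cq_algebra bialgA.
Let cmpA := cq_compatible bialgA.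
Let homS := C2_hom C2S.
Let homS' : hom2 S'. Proof. by case: SS'. Qed.
Local Notation R := (breg B).
Local Notation "X *' Y" := (lmul A X Y) (at level 40, left associativity).

Local Notation coalg_of dP := (bialg_coalg algA cmpA dP).
Local Notation mul_of dP := (bialg_mul algA cmpA dP).

Local Notation cop2P := (@sweedler_cop2 k B L).
Local Notation C := (coalg_of cop2P).
Local Notation m := (mul_of cop2P).

(** For trivial Phi the two sides of quasi-associativity are convolutions of the two bracketings
    with the counit of the triple tensor product, hence the bracketings themselves. *)
Lemma mul_assoc X Y Z : X *' Y *' Z = X *' (Y *' Z).
Proof.
have := coc_assoc (cq_cocycle bialgA) X Y Z.
pose id_ := id_hom algA cmpA cop2P.
pose Fl := pull (cmor_comp m (tmor m (idmor C))) id_.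
pose Fr := pull (cmor_comp m (cmor_comp (tmor (idmor C) m) (tassoc C C C))) id_.
have epsE x y z : eps3 A x y z = cou (((x, y), z) : C ** C ** C).
  exact: (c_cou (cmor_comp m (tmor m (idmor C))) ((x, y), z)).
move=> H; transitivity (lconv (hcou _) Fl ((X, Y), Z)); first by rewrite lconv1.
transitivity (rconv Fr (hcou _) ((X, Y), Z)); last by rewrite rconv1.
rewrite [LHS](tens3_sumE (fun w w' => mla (hcou (C ** C ** C) w) (Fl w'))).
rewrite [RHS](tens3_sumE (fun w w' => mlb (hcou (C ** C ** C) w') (Fr w))).
rewrite /= in H *.
transitivity (\sum_(x <- cop2 X) \sum_(y <- cop2 Y) \sum_(z <- cop2 Z)
  lact (eps3 A x.1 y.1 z.1) (x.2 *' y.2 *' z.2)).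
  do 3!(apply: eq_bigr => ? _); by rewrite epsE.
rewrite H.
do 3!(apply: eq_bigr => ? _); by rewrite epsE.
Qed.

Lemma good_S X Y b : S X (ract Y b) = S X (ractbar Y b).
Proof. by rewrite (C2_ract C2S). Qed.

Section Inverse.
Variables (f g : L -> L -> B) (fP : hom2 f) (gP : hom2 g).
Hypothesis fg : forall X Y, conv2 f g X Y = eps2 A X Y.
Let hf : hom (C ** C) R := hom2_hom algA cmpA cop2P fP.
Let hg : hom (C ** C) R := hom2_hom algA cmpA cop2P gP.

Lemma conv2_lconv : lconv hf hg = hcou (C ** C).
Proof.
apply: hom_eq => -[X Y].
rewrite [LHS](tens2_sumE (fun w w' => mla (hf w) (hg w'))).
by rewrite -[RHS](c_cou m (X, Y)) -[RHS]/(eps2 A X Y) -fg.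
Qed.

End Inverse.

(** [in_C2] records this symmetry for S; [good_inv] transfers it to the inverse. *)
Lemma good_S' X Y b : S' X (ract Y b) = S' X (ractbar Y b).
Proof.
have [_ Sl Sr] := SS'.
have gS : good (hom2_hom algA cmpA cop2P homS).
  by move=> [x y] c; apply: good_S.
exact: (good_inv gS (conv2_lconv homS homS' Sl) (conv2_lconv homS' homS Sr) (X, Y) b).
Qed.

Section Choice.
Variable d : L -> seq (L * L).
Hypothesis dP : sweedler_choice d.

Lemma good_hom2 f (fP : hom2 f) :
  (forall X Y b, f X (ract Y b) = f X (ractbar Y b)) ->
  good (hom2_hom algA cmpA dP fP).
Proof. by move=> fb [X Y] b; apply: fb. Qed.

Definition sigma : dual (coalg_of dP ** coalg_of dP) :=
  Dual (good_hom2 homS good_S).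
Definition sigmaV : dual (coalg_of dP ** coalg_of dP) :=
  Dual (good_hom2 homS' good_S').

Lemma sigmaE p : sigma p = S p.1 p.2.
Proof. by []. Qed.

Lemma sigmaVE p : sigmaV p = S' p.1 p.2.
Proof. by []. Qed.


(** The identity map is a morphism because two representatives of the same coproduct agree under
    every balanced map. *)
Definition choice_mor : cmor (coalg_of dP) C.
Proof.
refine (@Cmor B (coalg_of dP) C id _ _ _ _ _ _ _) => //.
move=> G K c KP.
by rewrite (sweedler_sum dP c KP) (sweedler_sum cop2P c KP).
Defined.

End Choice.

Local Notation s := (sigma cop2P).
Local Notation s' := (sigmaV cop2P).

Lemma sigmaK : dmul s s' = dunit (C ** C).
Proof.
have [_ Sl _] := SS'; apply: dual_eq => c.
by rewrite -[RHS]/(hcou (C ** C) c) -(conv2_lconv homS homS' Sl).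
Qed.

Lemma sigmaVK : dmul s' s = dunit (C ** C).
Proof.
have [_ _ Sr] := SS'; apply: dual_eq => c.
by rewrite -[RHS]/(hcou (C ** C) c) -(conv2_lconv homS' homS Sr).
Qed.

Lemma coboundary_of_indep (d : L -> seq (L * L)) X Y Z :
  sweedler_choice d -> coboundary_of A d S S' X Y Z = coboundary A S S' X Y Z.
Proof.
move=> dP; rewrite /coboundary.
rewrite (@coboundary_ofE _ _ _ _ _ _ _ dP _ _ _ _ (@sigmaE d dP) (@sigmaVE d dP)).
rewrite (@coboundary_ofE _ _ _ _ _ _ _ _ _ _ _ _ (@sigmaE _ cop2P) (@sigmaVE _ cop2P)).
apply: (@drinfeld_pullE _ _ _ (mul_of dP) m (choice_mor dP) s s'
  (sigma dP) (sigmaV dP) X Y Z) => [p|[x y]|[x y]]; first by [].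
- exact: etrans (sigmaE (x, y)) (esym (@sigmaE _ cop2P (x, y))).
- exact: etrans (sigmaVE (x, y)) (esym (@sigmaVE _ cop2P (x, y))).
Qed.

Lemma twist_mul_of_indep (d : L -> seq (L * L)) X Y : sweedler_choice d ->
  twist_mul_of A d S S' X Y = twist_mul_of A (@cop2 k B L) S S' X Y.
Proof.
move=> dP; pose i := choice_mor dP.
rewrite (@twist_mul_ofE _ _ _ _ _ _ _ dP _ _ _ _ (@sigmaE d dP) (@sigmaVE d dP)).
rewrite (@twist_mul_ofE _ _ _ _ _ _ _ _ _ _ _ _ (@sigmaE _ cop2P) (@sigmaVE _ cop2P)).
apply: (@twist_hom_pullE _ _ _ _ _ _ _ _ _ _ _ _ (mul_of dP) m (tmor i i)
  (sigma dP) (sigmaV dP) s s' (X, Y)) => [p|[x y]|[x y]]; first by [].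
- exact: etrans (sigmaE (x, y)) (esym (@sigmaE _ cop2P (x, y))).
- exact: etrans (sigmaVE (x, y)) (esym (@sigmaVE _ cop2P (x, y))).
Qed.

Definition twist_mul : cmor (C ** C) C := twist_cmor m sigmaK sigmaVK.

End FinalAssembly.

Lemma exchange_big1221 (G : zmodType) (I J1 J2 K1 K2 H : Type)
    (r : seq I) (s1 : seq J1) (s2 : J1 -> seq J2) (t1 : seq K1)
    (t2 : K1 -> seq K2) (q : seq H) (F : I -> J1 -> J2 -> K1 -> K2 -> H -> G) :
  \sum_(x <- r) \sum_(y <- s1) \sum_(y' <- s2 y) \sum_(z <- t1)
    \sum_(z' <- t2 z) \sum_(w <- q) F x y y' z z' w =
  \sum_(y <- s1) \sum_(z <- t1) \sum_(w <- q) \sum_(y' <- s2 y)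
    \sum_(z' <- t2 z) \sum_(x <- r) F x y y' z z' w.
Proof.
rewrite exchange_big; apply: eq_bigr => y _; rewrite exchange_big.
under eq_bigr do rewrite exchange_big.
rewrite exchange_big; apply: eq_bigr => z _.
under eq_bigr do under eq_bigr do rewrite exchange_big.
under eq_bigr do rewrite exchange_big.
rewrite exchange_big; apply: eq_bigr => w _; apply: eq_bigr => y' _.
by rewrite exchange_big.
Qed.

(** * From convolution identities back to the axioms of a coquasi-bialgebroid *)

Section FromHom.
Variables (k : fieldType) (B : algType k) (L : coalgebroid B) (A : alg_data L).
Hypotheses (algA : is_algebra_over A) (cmpA : is_compatible A).
Local Notation cop2P := (@sweedler_cop2 k B L).
Local Notation C := (bialg_coalg algA cmpA cop2P).
Local Notation M := (bimod_bmod L).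
Local Notation oneP := (lone_unit algA cmpA cop2P).

Variable g : hom (C ** C) M.
Hypothesis g_ra : forall X Y b, g (X, ract Y b) = ract (g (X, Y)) b.
Hypothesis g_rb : forall X Y b, g (X, ractbar Y b) = ractbar (g (X, Y)) b.
Hypothesis g1x : forall X, g (lone A, X) = X.
Hypothesis gx1 : forall X, g (X, lone A) = X.
Hypothesis g_delta : delta_hom g = pure_hom g g.
Hypothesis g_eps : forall X Y, eps (g (X, Y)) = eps (ract X (eps Y)).

Local Notation Ag := (AlgData (lone A) (fun X Y => g (X, Y)) (lsrc A) (ltgt A)).

Let gla b X Y : g (lact b X, Y) = lact b (g (X, Y)) := h_la g b (X, Y).
Let glb b X Y : g (lactbar b X, Y) = lactbar b (g (X, Y)) := h_lb g b (X, Y).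
Let gba X b Y : g (ract X b, Y) = g (X, lact b Y) := tens_bal (h_adm g) X b Y.
Let gbb X b Y : g (ractbar X b, Y) = g (X, lactbar b Y) :=
  tens_balbar (h_adm g) X b Y.

Let srcE b : lsrc A b = lact b (lone A).
Proof. by rewrite (lact_src algA) (mulX1 algA). Qed.

Let tgtE b : ltgt A b = lactbar b (lone A).
Proof. by rewrite (lactbar_tgt algA) (mulX1 algA). Qed.

(** As s(b) = b 1 and t(b) = \bar b 1, the conditions on s and t reduce to linearity, balancing and
    unit laws of g, together with the relations that already hold for A. *)
Lemma algebra_of_hom : is_algebra_over Ag.
Proof.
have gZl (a : k) X Y : g (a *: X, Y) = a *: g (X, Y).
  by rewrite -lact_scale gla lact_scale.
split=> //=.
- move=> Y; apply: addmap_linear => // X X'.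
  exact: (tens_adml (h_adm g) Y).
- move=> X; apply: addmap_linear => [Y Y'|a Y].
    exact: (tens_admr (h_adm g) X).
  by rewrite -gZl -(ract_scale a X) gba lact_scale.
- exact: src_linear algA.
- exact: src1 algA.
- move=> b c; rewrite (srcE c) -gba gx1 (ract_src algA).
  exact: srcM algA b c.
- exact: tgt_linear algA.
- exact: tgt1 algA.
- move=> b c; rewrite (tgtE b) -gbb gx1 (ractbar_tgt algA).
  exact: tgtM algA b c.
- move=> b c; transitivity (lact b (ltgt A c)); first by rewrite srcE gla g1x.
  rewrite (lact_src algA) (src_tgt algA) -(lactbar_tgt algA).
  by rewrite (tgtE c) glb g1x.
- by move=> b X; rewrite srcE gla g1x.
- by move=> b X; rewrite tgtE glb g1x.
- by move=> X b; rewrite srcE -gba gx1.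
- by move=> X b; rewrite tgtE -gbb gx1.
Qed.

Lemma compatible_of_hom : is_compatible Ag.
Proof.
split=> /=.
- exact: Delta1 cmpA.
- move=> X Y; rewrite -[Delta _]/(delta_hom g (X, Y)) g_delta.
  exact: (tens2_sumE (fun w w' : C ** C => pure2 (g w : L) (g w'))).
- exact: eps1 cmpA.
- by move=> X Y; rewrite g_eps.
- by move=> X Y; rewrite g_eps (eps_rab cmpA).
Qed.

Variable h : cmor (C ** C) C.
Hypothesis hE : forall p, h p = g p.
Variables u v : dual (C ** C ** C).
Hypotheses (uv : dmul u v = dunit (C ** C ** C))
  (vu : dmul v u = dunit (C ** C ** C)).
Hypothesis u_1xy : dpull (tmor (insl oneP C) (idmor C)) u = dunit (C ** C).
Hypothesis u_x1y : dpull (tmor (insr oneP C) (idmor C)) u = dunit (C ** C).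
Hypothesis u_xy1 : dpull (insr oneP (C ** C)) u = dunit (C ** C).
Hypothesis u_cocycle : dmul (dpull (mul3 h) u) (dpull (mul1 h) u) =
  dmul (tail4 u) (dmul (dpull (mul2 h) u) (head4 u)).
Local Notation idh := (id_hom algA cmpA cop2P).
Hypothesis u_assoc :
  lconv u (pull (cmor_comp h (tmor h (idmor C))) idh) =
  rconv (pull (cmor_comp h (cmor_comp (tmor (idmor C) h) (tassoc C C C))) idh) u.

Local Notation Phi := (fun X Y Z => u ((X, Y), Z)).

(** The unit [eps3 Ag] is written with the twisted product, but h preserves counits, so it is still
    the counit of the triple tensor product. *)
Lemma conv3_of_dual (w w' : dual (C ** C ** C)) X Y Z :
  dmul w w' = dunit (C ** C ** C) ->
  conv3 (fun X Y Z => w ((X, Y), Z)) (fun X Y Z => w' ((X, Y), Z)) X Y Z =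
  eps3 Ag X Y Z.
Proof.
move=> ww'; transitivity (dmul w w' ((X, Y), Z)).
  exact/esym/(tens3_sumE (fun p q => mla (w p) (w' q))).
rewrite ww' -[LHS](c_cou (cmor_comp h (tmor h (idmor C))) ((X, Y), Z)).
by rewrite /eps3 /= !hE.
Qed.

Lemma cocycle_of_dual : normalised_cocycle3 Ag Phi.
Proof.
have dunitE X Y : dunit (C ** C) (X, Y) = eps (g (X, Y)).
  by rewrite -hE; apply: esym (c_cou h (X, Y)).
split=> /=.
- exact: hom3_hom.
- exists (fun X Y Z => v ((X, Y), Z)); split; first exact: hom3_hom.
  + by move=> X Y Z; apply: conv3_of_dual.
  + by move=> X Y Z; apply: conv3_of_dual.
- by move=> X Y; rewrite -dunitE -u_1xy.
- by move=> X Y; rewrite -dunitE -u_x1y.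
- by move=> X Y; rewrite -dunitE -u_xy1.
- by move=> X Y Z b; apply: (dualP u ((X, Y), Z) b).
- move=> X Y Z W.
  transitivity (dmul (dpull (mul3 h) u) (dpull (mul1 h) u) (((X, Y), Z), W)).
    rewrite [RHS](tens4_sumE (fun p q => mla (dpull (mul3 h) u p) (dpull (mul1 h) u q))).
    by do 4!(apply: eq_bigr => ? _); rewrite !dpullE /= !hE.
  rewrite u_cocycle cocycle_rhsE.
  transitivity (\sum_(y <- cop2 Y) \sum_(z <- cop2 Z) \sum_(w <- cop2 W)
    \sum_(y' <- cop2 y.2) \sum_(z' <- cop2 z.2) \sum_(x <- cop2 X)
    u ((x.1, lact (u ((y.1, z.1), w.1)) (g (y'.1, z'.1))), w.2) *
    u ((x.2, y'.2), z'.2)).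
    rewrite (tens3_sumE (fun q r : C ** C ** C => \sum_(p <- cop r.1) \sum_(c <- cop2 X)
      dpull (mul2 h) u (((c.1, la (u q) p.1.1), p.1.2), r.2) *
      u ((c.2, p.2.1), p.2.2))).
    apply: eq_bigr => y _; apply: eq_bigr => z _; apply: eq_bigr => w _ /=.
    rewrite (tens2_sumE (fun p r : C ** C => \sum_(c <- cop2 X)
      dpull (mul2 h) u (((c.1, la (u ((y.1, z.1), w.1)) p.1), p.2), w.2) *
      u ((c.2, r.1), r.2))).
    by do 3!(apply: eq_bigr => ? _); rewrite dpullE /= !hE gla.
  rewrite -exchange_big1221; apply: eq_bigr => x _.
  rewrite big_allpairs_dep; apply: eq_bigr => y _; apply: eq_bigr => y' _.
  rewrite big_allpairs_dep; apply: eq_bigr => z _; apply: eq_bigr => z' _.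
  by apply: eq_bigr => w _; case: x w => [x1 x2] [w1 w2].
- move=> X Y Z.
  transitivity (lconv u (pull (cmor_comp h (tmor h (idmor C))) idh) ((X, Y), Z)).
    rewrite [RHS](tens3_sumE (fun p q => mla (u p)
      (pull (cmor_comp h (tmor h (idmor C))) idh q))).
    by do 3!(apply: eq_bigr => ? _); rewrite /= !hE.
  rewrite u_assoc.
  rewrite [LHS](tens3_sumE (fun p q => mlb (u q)
      (pull (cmor_comp h (cmor_comp (tmor (idmor C) h) (tassoc C C C))) idh p))).
  by do 3!(apply: eq_bigr => ? _); rewrite /= !hE.
Qed.

End FromHom.

(** * The coquasi-bialgebroid obtained by twisting *)

Theorem corollary2p5 (k : fieldType) (B : algType k) (L : coalgebroid B)
    (A : alg_data L) (S S' : L -> L -> B) :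
  bialgebroid A -> in_C2 A S -> conv_inverse2 A S S' ->
  (forall d : L -> seq (L * L), sweedler_choice d ->
     (forall X Y Z,
        coboundary_of A d S S' X Y Z = coboundary A S S' X Y Z) /\
     (forall X Y, twist_mul_of A d S S' X Y = lmul (twist A S S') X Y)) /\
  coquasi_bialgebroid_with (twist A S S') (coboundary A S S').
Proof.
move=> bialgA C2S SS'; split=> [d dP|].
  split=> *; first exact: coboundary_of_indep.
  exact: twist_mul_of_indep.
have algA := cq_algebra bialgA; have cmpA := cq_compatible bialgA.
pose dP := @sweedler_cop2 k B L.
pose s := sigma bialgA C2S dP; pose s' := sigmaV bialgA C2S SS' dP.
pose m := bialg_mul (cq_algebra bialgA) (cq_compatible bialgA) dP.
pose g := twist_hom m s s'; pose h := twist_mul bialgA C2S SS'.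
pose oneP := lone_unit (cq_algebra bialgA) (cq_compatible bialgA) dP.
have ss' : dmul s s' = dunit _ := sigmaK bialgA C2S SS'.
have s's : dmul s' s = dunit _ := sigmaVK bialgA C2S SS'.
have mA x y z : m (m (x, y), z) = m (x, m (y, z)) := mul_assoc bialgA x y z.
have m1x x : m (lone A, x) = x := mul1X algA x.
have mx1 x : m (x, lone A) = x := mulX1 algA x.
have s1x x : s (lone A, x) = cou x := C2_unitl C2S x.
have sx1 x : s (x, lone A) = cou x := C2_unitr C2S x.
have hC : sconj_by h m s s' := twist_sconj m ss' s's.
have -> : twist A S S' =
    AlgData (lone A) (fun X Y => g (X, Y)) (lsrc A) (ltgt A).
  rewrite /twist; congr AlgData; apply/funext => X; apply/funext => Y.
  by apply: twist_mul_ofE => p; [exact: sigmaE | exact: sigmaVE].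
have -> : coboundary A S S' = fun X Y Z => drinfeld m s s' ((X, Y), Z).
  apply/funext => X; apply/funext => Y; apply/funext => Z.
  by apply: coboundary_ofE => p; [exact: sigmaE | exact: sigmaVE].
have g_ra X Y b : g (X, ract Y b) = ract (g (X, Y)) b.
  exact: (twist_hom_ra m s s' (X, Y) b).
have g_rb X Y b : g (X, ractbar Y b) = ractbar (g (X, Y)) b.
  exact: (twist_hom_rb m s s' (X, Y) b).
have g1x X : g (lone A, X) = X.
  rewrite -[LHS]/(g (insl oneP _ X)) twist_hom_trivial /= ?(mul1X algA) //.
    by apply: dual_eq => x; apply: s1x.
  by apply: dual_eq => x; apply: (s'1x ss' oneP s1x).
have gx1 X : g (X, lone A) = X.
  rewrite -[LHS]/(g (insr oneP _ X)) twist_hom_trivial /= ?(mulX1 algA) //.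
    by apply: dual_eq => x; apply: sx1.
  by apply: dual_eq => x; apply: (s'x1 ss' oneP sx1).
have g_eps X Y : eps (g (X, Y)) = eps (ract X (eps Y)).
  exact: (eps_twist m ss' (X, Y)).
have g_delta : delta_hom g = pure_hom g g := delta_twist m s's.
split.
- exact: algebra_of_hom.
- exact: compatible_of_hom.
- apply: (@cocycle_of_dual _ _ _ _ _ _ g h _
    (drinfeld m s s') (drinfeld_inv m s s')) => [p|||||||].
  + by [].
  + exact: drinfeldV.
  + exact: drinfeldVl.
  + by apply: drinfeld_1xy; assumption.
  + by apply: drinfeld_x1y; assumption.
  + by apply: drinfeld_xy1; assumption.
  + exact: drinfeld_cocycle.
  + exact: drinfeld_assoc.
Qed.
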